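(* Let $\gamma\ge 2$, $B(x)=x^\gamma$ and $b(y,x)=2y^{\gamma-1}$. Let $g_{\rm in}\in L^1((0,\infty),x\,dx)\cap L^2((0,\infty),x\,dx)$ and put $\rho_{\rm in}:=\int_0^\infty x\,g_{\rm in}(x)\,dx$. Let $g\in C([0,\infty),L^1((0,\infty),x\,dx))$ be the unique solution (in the sense specified in the context) of the self-similar fragmentation equation $$\partial_t g(t,x)+\partial_x\bigl(x\,g(t,x)\bigr)+g(t,x)=\gamma\,(\mathcal F g(t,\cdot))(x),\quad t\ge 0,\ x>0,\qquad g(0,x)=g_{\rm in}(x),\quad x>0,$$ where $$\mathcal F u(x):=\int_x^\infty b(y,x)\,u(y)\,dy-B(x)u(x)=2\int_x^\infty y^{\gamma-1}u(y)\,dy-x^\gamma u(x).$$ Let $G$ be the unique positive steady state with normalized mass, i.e. the solution of $(xG)'+G=\gamma\mathcal F G$, $G>0$, $\int_0^\infty xG(x)\,dx=1$. Then for all $t\ge 0$, $$\|g(t,\cdot)-\rho_{\rm in}G\|_{L^2(x\,dx)}\le \|g_{\rm in}-\rho_{\rm in}G\|_{L^2(x\,dx)}\,e^{-t}.$$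
   Context: All functions are real-valued on $(0,\infty)$, and $L^p(x\,dx)$ denotes $L^p((0,\infty),x\,dx)$, with $\|u\|_{L^2(x\,dx)}^2=\int_0^\infty x\,u(x)^2\,dx$. Solution: the solution $g$ of the self-similar equation is the one associated with the solution $f$ of the fragmentation equation $\partial_t f=\mathcal F f$, $f(0,\cdot)=g_{\rm in}$, through the change of variables $g(t,x)=e^{-2t}f(e^{\gamma t}-1,e^{-t}x)$. Here $f$ is the unique solution in the class $$f\in C([0,\infty);L^1((0,\infty),x\,dx))\cap L^1_{loc}([0,\infty);L^1((0,\infty),x^{1+\gamma}\,dx))$$ satisfying the mass conservation $\int_0^\infty x f(t,x)\,dx=\int_0^\infty x g_{\rm in}(x)\,dx$ for all $t>0$; for $f$ in this class $\mathcal F f\in L^1_{loc}([0,\infty);L^1(x\,dx))$, and the equation means $f(t)=g_{\rm in}+\int_0^t\mathcal F f(s)\,ds$ in $L^1(x\,dx)$ for all $t\ge0$. Steady state: for these coefficients the steady state is given explicitly by $G(x)=\frac{\gamma}{\Gamma(2/\gamma)}e^{-x^\gamma}$, where $\Gamma$ is the Euler Gamma function. *)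

(* Defs.v *)
From HB Require Import structures.
From mathcomp Require Import all_boot all_order all_algebra.
From mathcomp Require Import all_classical all_reals all_analysis.
Set Implicit Arguments.
Unset Strict Implicit.
Unset Printing Implicit Defensive.
Import Order.TTheory GRing.Theory Num.Theory.
Import numFieldNormedType.Exports.
Local Open Scope classical_set_scope.
Local Open Scope ring_scope.

Section Fragmentation.
Variable R : realType.
Notation mu := (@lebesgue_measure R).

(* Elements of the weighted spaces are represented by Borel functions R -> R
   of which only the values on (0, +oo) matter. The (semi)norms take values
   in \bar R, so that a finite bound on one of them includes membership. *)
Definition L1norm (w u : R -> R) : \bar R :=
  (\int[mu]_(x in `](0:R)%R, +oo[) (w x * `|u x|)%:E)%E.

Definition inL1 (w u : R -> R) : Prop :=
  measurable_fun `](0:R), +oo[ u /\ (L1norm w u < +oo)%E.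

Definition L2norm (w u : R -> R) : \bar R :=
  ((\int[mu]_(x in `](0:R)%R, +oo[) (w x * u x ^+ 2)%:E) `^ 2^-1)%E.

Definition inL2 (w u : R -> R) : Prop :=
  measurable_fun `](0:R), +oo[ u /\ (L2norm w u < +oo)%E.

(* The weights of the measures x dx and x^(1+gamma) dx. *)
Definition wmass (x : R) : R := x.
Definition wmom (gamma x : R) : R := x `^ (1 + gamma).

Definition mass (u : R -> R) : R := \int[mu]_(x in `](0:R), +oo[) (x * u x).

(* u \in C([0, +oo); L^1(w dx)) *)
Definition contL1 (w : R -> R) (u : R -> R -> R) : Prop :=
  (forall t, 0 <= t -> inL1 w (u t)) /\
  (forall t0, 0 <= t0 ->
    L1norm w (fun x => u t x - u t0 x)
      @[t --> within `[(0:R), +oo[ (nbhs t0)] --> 0%E).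

(* u \in L^1_loc([0, +oo); L^1(w dx)), for u measurable in both variables
   (which takes care of strong measurability). *)
Definition locL1 (w : R -> R) (u : R -> R -> R) : Prop :=
  forall T : R, 0 < T -> (\int[mu]_(t in `[(0:R)%R, T]) L1norm w (u t) < +oo)%E.

(* h is the Bochner integral of s |-> u s over [0, T] in L^1(w dx):
   the \sum_(i < N k) \1_(A k i) * v k i are simple functions from [0, T] to
   L^1(w dx). *)
Definition bochner_int (w : R -> R) (T : R) (u : R -> R -> R) (h : R -> R)
    : Prop :=
  inL1 w h /\
  exists (N : nat -> nat) (A : nat -> nat -> set R) (v : nat -> nat -> R -> R),
    let S k (s x : R) : R := \sum_(i < N k) \1_(A k i) s * v k i x in
    [/\ forall k i, (i < N k)%N ->
          [/\ measurable (A k i), A k i `<=` `[0, T] & inL1 w (v k i)],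
        {ae mu, forall s, 0 <= s <= T ->
          L1norm w (fun x => u s x - S k s x) @[k --> \oo] --> 0%E},
        (\int[mu]_(s in `[(0:R)%R, T]) L1norm w (fun x => u s x - S k s x)%R)%E
          @[k --> \oo] --> 0%E &
        L1norm w (fun x => h x - \sum_(i < N k) fine (mu (A k i)) * v k i x)
          @[k --> \oo] --> 0%E].

Definition fragB (gamma x : R) : R := x `^ gamma.
Definition fragb (gamma y x : R) : R := 2 * y `^ (gamma - 1).

Definition fragop (gamma : R) (u : R -> R) (x : R) : R :=
  \int[mu]_(y in `]x, +oo[) (fragb gamma y x * u y) - fragB gamma x * u x.

(* Every element of C([0, +oo); L^1(x dx)) has a representative that is Borel
   in (t, x); f is such a representative. *)
Definition frag_solution (gamma : R) (gin : R -> R) (f : R -> R -> R) : Prop :=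
  [/\ measurable_fun (`[(0:R), +oo[ `*` `](0:R), +oo[) (fun p : R * R => f p.1 p.2),
      contL1 wmass f,
      locL1 (wmom gamma) f,
      forall t, 0 < t -> mass (f t) = mass gin &
      forall t, 0 <= t ->
        bochner_int wmass t (fun s => fragop gamma (f s))
          (fun x => f t x - gin x)].

(* The solution of
     d_t g + d_x (x g) + g = gamma * fragop gamma g,  g(0, .) = gin,
   associated with f by the self-similar change of variables; the identity
   holds between classes of functions, hence for almost every x. *)
Definition selfsim_solution (gamma : R) (gin : R -> R) (g : R -> R -> R)
    : Prop :=
  contL1 wmass g /\
  exists2 f, frag_solution gamma gin f &
    forall t, 0 <= t -> {ae mu, forall x : R, 0 < x ->
      g t x = expR (- 2 * t) * f (expR (gamma * t) - 1) (expR (- t) * x)}.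

(* Integrability on each ]x, +oo[ is what gives a meaning to the integral in
   fragop (\int is total). *)
Definition steady_state (gamma : R) (G : R -> R) : Prop :=
  [/\ forall x : R, 0 < x -> 0 < G x,
      inL1 wmass G,
      mass G = 1,
      forall x : R, 0 < x ->
        mu.-integrable `]x, +oo[ (fun y => (fragb gamma y x * G y)%:E) &
      forall x : R, 0 < x ->
        derivable (fun y : R => y * G y) x 1 /\
        derive1 (fun y : R => y * G y) x + G x = gamma * fragop gamma G x].

End Fragmentation.

(* Main.v *)
(* Undoing the self-similar scaling, set u = f - rho f_G with rho the mass of
   gin, f_G(t, x) = l^2 G(l x) and l = (1 + t)^(1/gamma). Then u solves the
   fragmentation equation with zero mass, and going back to g at time t dilates
   x by e^(-t), which multiplies the norm of L^2(x dx) by e^(-t); so it suffices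
   that the norm of u does not increase. Put M(t, x) = int_0^x y u(t, y) dy and
   D(t, x) = int_x^oo y^(gamma-1) u(t, y) dy. The equation reads
   d_t M = x^2 D, the squared norm of u is the integral of (d_x M)^2 / x, and
   formally half of its time derivative is
     int d_x M d_x (x^2 D) / x = int 2 D d_x M - int x^(gamma-1) (d_x M)^2,
   where int 2 D d_x M = int 2 x^(gamma-2) M d_x M
     = - (gamma - 2) int x^(gamma-3) M^2 <= 0
   because M vanishes at 0 and at infinity.

   As u is only known to be continuous in time with values in L^1(x dx), the
   computation is made on a finite grid of ]0, n], where the norm becomes
   sum (M(x_(i+1)) - M(x_i))^2 / (x_(i+1)^2 - x_i^2) up to a factor, and with
   M(t, x) - (x / n)^2 M(t, n) instead of M(t, x): its time derivative
   x^2 int_x^n y^(gamma-1) u is continuous in t, since what comes from the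
   particles larger than n has been cancelled. The price of cutting at n is
   controlled by n^gamma int |M(t, n)| dt, which is bounded by the moment of
   order 1 + gamma. Refining the grid and letting n grow, the energy of the
   grid recovers the norm by Lebesgue differentiation. *)
Require Import Defs.
From mathcomp Require Import all_boot all_order all_algebra.
From mathcomp Require Import all_classical all_reals all_analysis.
From mathcomp Require Import measurable_realfun ring lra.
Set Implicit Arguments.
Unset Strict Implicit.
Unset Printing Implicit Defensive.
Import Order.TTheory GRing.Theory Num.Theory.
Import numFieldNormedType.Exports.
Local Open Scope classical_set_scope.
Local Open Scope ring_scope.

(** * Dissipation of the energy of a grid *)

(** The obstacle is the rate of change of the mass below [x]: it is [x^2] times an integral over all
    sizes larger than [x], which is only known to be finite for almost every time, without
    continuity. In the combination with [(x / n)^2] times the mass below [n], the two contributions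
    of the sizes beyond [n] are equal, so the corrected mass is differentiable at every positive
    time and a finite energy can be differentiated. In the variable [s = x^2] the energy of a grid
    is a discrete Dirichlet energy of the mass, and the correction subtracts the linear function of
    [s] with the same end values, so that it changes the energy by one explicit term. The two limits
    are taken together: the mesh is chosen after [n], fine enough to beat the powers [n^(gamma - 2)]
    in the discretization errors. The assumption [gamma >= 2] makes [x^(gamma - 2)] nondecreasing,
    which gives the dissipation its sign. The steady state is known only through its equation.
    Integrated once, the equation says that [G x] is [gamma] times the integral of
    [y^(gamma - 1) G y] beyond [x]; monotonicity, the tail bound and the evolution of the dilated
    profile rest on this. *)

Lemma discrete_dissipation_step (F : realFieldType)
    (s s' a a' m m' D D' I V C delta eps W : F) :
  0 <= s -> s < s' -> 0 <= a -> a <= a' -> 0 <= V -> 0 <= C ->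
  `|m' - m| <= V -> D - D' = I ->
  `|I - a * (m' - m)| <= (a' - a) * V -> `|m| <= W ->
  a' - a <= delta -> V <= eps -> s * (a' - a) <= C * (s' - s) ->
  (m' - m) * (s' * D' - s * D) / (s' - s) <=
    (m' * D' - m * D) + (a' * m' ^+ 2 - a * m ^+ 2) / 2
      + (W * delta + C * eps) * V.
Proof.
move=> s0 ss' a0 aa' V0 C0 mV <- RV mW ad Ve sC.
set R := D - D' - a * (m' - m) in RV *.
have ds : 0 < s' - s by rewrite subr_gt0.
have da : 0 <= a' - a by rewrite subr_ge0.
(* From [s' D' - s D = (s' - s) D' - s (D - D')], the quotient leaves [D'] and the ratio [r].
   Replacing [D - D'] by [a (m' - m)] turns [m (D - D')] into half the increment of [a m^2] minus
   nonnegative terms, and the term with [r] into minus a square; [R] carries the error. *)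
pose r := s / (s' - s).
have r0 : 0 <= r by rewrite divr_ge0// ltW.
have rC : r * (a' - a) <= C by rewrite /r mulrAC ler_pdivrMr.
have -> : (m' - m) * (s' * D' - s * D) / (s' - s) =
    (m' * D' - m * D) + m * (D - D') - r * (m' - m) * (D - D').
  by rewrite /r; field; rewrite gt_eqF.
have -> : D - D' = a * (m' - m) + R by rewrite /R; ring.
have RW : m * R <= W * delta * V.
  rewrite (le_trans (ler_norm _))// normrM -mulrA ler_pM//.
  by rewrite (le_trans RV)// ler_wpM2r.
have RC : - (r * (m' - m) * R) <= C * eps * V.
  rewrite (le_trans (ler_norm _))// normrN (normrM _ R) (normrM r) (ger0_norm r0).
  have : `|m' - m| * `|R| <= eps * ((a' - a) * V).
    by rewrite ler_pM// (le_trans mV).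
  move=> /(ler_wpM2l r0) h; rewrite -mulrA; apply: (le_trans h).
  rewrite [leLHS](_ : _ = (r * (a' - a)) * (eps * V)); last by ring.
  rewrite -[leRHS]mulrA; apply: ler_wpM2r => //.
  by rewrite mulr_ge0// (le_trans V0).
have sq : 0 <= r * a * (m' - m) ^+ 2 by rewrite mulr_ge0 ?sqr_ge0// mulr_ge0.
have aq : 0 <= a * (m' - m) ^+ 2 by rewrite mulr_ge0 ?sqr_ge0.
have amono : 0 <= (a' - a) * m' ^+ 2 by rewrite mulr_ge0 ?sqr_ge0.
clearbody r R; move: RW RC sq aq amono; rewrite !expr2 => RW RC sq aq amono; lra.
Qed.

(* Discrete form of [<F u, u> <= 0]: with [s = x^2], [m i] is the mass of [u]
   below the i-th node and [D i] the integral of [y^(gamma - 1) u] between the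
   i-th and the last node; both sides of the sum vanish at the end points, so
   that all the terms telescope up to the errors [delta] and [eps]. *)
Lemma discrete_dissipation (F : realFieldType) (N : nat)
    (s a m D V : nat -> F) (C delta eps W : F) :
  s 0%N = 0 -> m 0%N = 0 -> D N = 0 -> 0 <= a 0%N -> 0 <= C -> 0 <= delta ->
  0 <= eps ->
  (forall i, (i < N)%N -> s i < s i.+1) ->
  (forall i, (i < N)%N -> a i <= a i.+1) ->
  (forall i, (i < N)%N -> 0 <= V i <= eps) ->
  (forall i, (i < N)%N -> `|m i.+1 - m i| <= V i) ->
  (forall i, (i < N)%N ->
    `|D i - D i.+1 - a i * (m i.+1 - m i)| <= (a i.+1 - a i) * V i) ->
  (forall i, (i < N)%N -> `|m i| <= W) ->
  (forall i, (i < N)%N -> a i.+1 - a i <= delta) ->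
  (forall i, (i < N)%N -> s i * (a i.+1 - a i) <= C * (s i.+1 - s i)) ->
  \sum_(i < N) V i <= W ->
  \sum_(i < N) ((m i.+1 - s i.+1 / s N * m N) - (m i - s i / s N * m N)) *
      (s i.+1 * D i.+1 - s i * D i) / (s i.+1 - s i) <=
    a N * m N ^+ 2 / 2 + (W * delta + C * eps) * W.
Proof.
move=> s0 m0 DN a0 C0 d0 e0 sS aS Ve mV RV mW ad sC VW.
have s_ge0 i : (i <= N)%N -> 0 <= s i.
  elim: i => [|i ih] iN; first by rewrite s0.
  by rewrite ltW// (le_lt_trans (ih (ltnW iN))) ?sS.
have a_ge0 i : (i <= N)%N -> 0 <= a i.
  elim: i => [//|i ih] iN.
  by rewrite (le_trans (ih (ltnW iN))) ?aS.
have W0 : 0 <= W.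
  by apply: le_trans VW; apply: sumr_ge0 => i _; have /andP[] := Ve i (ltn_ord i).
(* The correction shifts each increment of [m] by [m N / s N] times that of [s]. Divided by the
   latter, it contributes a multiple of the increment of [s D], which telescopes to 0 because
   [s 0 = 0] and [D N = 0]. *)
apply: (@le_trans _ _ (\sum_(i < N) (((m i.+1 * D i.+1 - m i * D i)
    - m N / s N * (s i.+1 * D i.+1 - s i * D i)
    + (a i.+1 * m i.+1 ^+ 2 - a i * m i ^+ 2) / 2)
      + (W * delta + C * eps) * V i))).
  apply: ler_sum => i _; have iN := ltn_ord i.
  have ds : 0 < s i.+1 - s i by rewrite subr_gt0 sS.
  have /andP[V0 Vei] := Ve _ iN.
  have := @discrete_dissipation_step F (s i) (s i.+1) (a i) (a i.+1) (m i)
    (m i.+1) (D i) (D i.+1) (D i - D i.+1) (V i) C delta eps W.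
  move=> /(_ (s_ge0 i (ltnW iN)) (sS i iN) (a_ge0 i (ltnW iN)) (aS i iN) V0 C0
    (mV i iN) erefl (RV i iN) (mW i iN) (ad i iN) Vei (sC i iN)).
  rewrite -(lerD2r (- (m N / s N * (s i.+1 * D i.+1 - s i * D i)))).
  rewrite [X in X <= _ -> _](_ : _ = ((m i.+1 - s i.+1 / s N * m N)
     - (m i - s i / s N * m N)) *
      (s i.+1 * D i.+1 - s i * D i) / (s i.+1 - s i)).
    move/le_trans; apply; rewrite le_eqVlt; apply/orP; left; apply/eqP; ring.
  have -> : (m i.+1 - s i.+1 / s N * m N) - (m i - s i / s N * m N) =
    (m i.+1 - m i) - m N / s N * (s i.+1 - s i) by ring.
  move: (m N / s N) => k.
  by field; rewrite gt_eqF.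
rewrite big_split/= -mulr_sumr lerD//; last first.
  by rewrite ler_wpM2l// addr_ge0// mulr_ge0.
rewrite big_split/= big_split/= sumrN -mulr_sumr -mulr_suml.
have tel (g : nat -> F) : \sum_(i < N) (g i.+1 - g i) = g N - g 0%N.
  by rewrite -telescope_sumr// big_mkord.
rewrite (tel (fun i => m i * D i)) (tel (fun i => s i * D i)).
rewrite (tel (fun i => a i * m i ^+ 2)) DN s0 m0.
by rewrite !(mulr0, mul0r, expr2, subr0, oppr0, add0r).
Qed.

(** Pythagoras for the weights [1 / (s i.+1 - s i)]: with [k = m N / s N], the increments of
    [m - k s] are orthogonal to those of [s], since their sum vanishes. The last term is the energy
    of [k s]. *)
Lemma discrete_energy_split (F : realFieldType) (N : nat) (s m : nat -> F) :
  s 0%N = 0 -> m 0%N = 0 -> s N != 0 ->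
  (forall i, (i < N)%N -> s i < s i.+1) ->
  \sum_(i < N) 2 * (m i.+1 - m i) ^+ 2 / (s i.+1 - s i) =
  \sum_(i < N) 2 * ((m i.+1 - s i.+1 / s N * m N) - (m i - s i / s N * m N)) ^+ 2
      / (s i.+1 - s i)
  + 2 * m N ^+ 2 / s N.
Proof.
move=> s0 m0 sN sS; pose k := m N / s N.
have tel (g : nat -> F) : \sum_(i < N) (g i.+1 - g i) = g N - g 0%N.
  by rewrite -telescope_sumr// big_mkord.
rewrite [LHS](_ : _ = \sum_(i < N)
   (2 * ((m i.+1 - s i.+1 / s N * m N) - (m i - s i / s N * m N)) ^+ 2
      / (s i.+1 - s i)
    + (4 * k * ((m i.+1 - s i.+1 / s N * m N) - (m i - s i / s N * m N))
    + 2 * k ^+ 2 * (s i.+1 - s i)))); last first.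
  apply: eq_bigr => i _; have := sS i (ltn_ord i); rewrite -subr_gt0 => ds.
  by rewrite /k; field; rewrite sN gt_eqF.
rewrite big_split/=; congr (_ + _); rewrite big_split/= -!mulr_sumr.
rewrite (tel (fun i => m i - s i / s N * m N)) tel s0 m0 /k.
by field.
Qed.

(** The derivative of the energy is 4 times the sum bounded in the last hypothesis, so [P], the
    energy minus the integral of the resulting bound, is nonincreasing. Derivatives are known only
    at positive times; time 0 is reached by continuity. *)
Lemma discrete_energy_growth (R : realType) (N : nat) (s : nat -> R)
    (q D : R -> nat -> R) (B : R -> R) (T K : R) :
  0 <= T -> continuous B ->
  (forall i, (i <= N)%N -> continuous (q ^~ i)) ->
  (forall (t : R) i, 0 < t -> (i <= N)%N -> is_derive t 1 (q ^~ i) (s i * D t i)) ->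
  (forall t : R, 0 < t < T ->
    \sum_(i < N) (q t i.+1 - q t i) * (s i.+1 * D t i.+1 - s i * D t i)
       / (s i.+1 - s i) <= B t + K) ->
  \sum_(i < N) 2 * (q T i.+1 - q T i) ^+ 2 / (s i.+1 - s i) <=
  \sum_(i < N) 2 * (q 0 i.+1 - q 0 i) ^+ 2 / (s i.+1 - s i)
    + 4 * (\int[lebesgue_measure]_(r in `[0, T]) B r + K * T).
Proof.
move=> T0 cB cq dq DB.
pose E (t : R) := \sum_(i < N) 2 * (q t i.+1 - q t i) ^+ 2 / (s i.+1 - s i).
pose b t : R := \int[lebesgue_measure]_(r in `[0, t]) B r.
have iB (t : R) : lebesgue_measure.-integrable `[0, t] (EFin \o B).
  apply: continuous_compact_integrable; first exact: segment_compact.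
  exact: continuous_subspaceT.
pose P (t : R) := E t - 4 * (b t + K * t).
have E_ext : E = \sum_(i < N) ((2 / (s i.+1 - s i)) *:
    ((q ^~ i.+1 \- q ^~ i) ^+ 2)).
  apply/funext => t; rewrite /E fct_sumE; apply: eq_bigr => i _.
  by rewrite !fctE/= /GRing.scale/= mulrAC.
have dP (t : R) : 0 < t -> is_derive t 1 P (4 * (\sum_(i < N) (q t i.+1 - q t i) *
     (s i.+1 * D t i.+1 - s i * D t i) / (s i.+1 - s i)) - 4 * (B t + K)).
  move=> t0.
  have tt1 : t < t + 1 by rewrite ltrDl.
  have db : is_derive t 1 b (B t).
    have [db1 db2] := continuous_FTC1_closed tt1 (iB _) t0 (cB t).
    by rewrite -db2 derive1E; exact/derivableP.
  have dE : is_derive t 1 E (4 * (\sum_(i < N) (q t i.+1 - q t i) *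
     (s i.+1 * D t i.+1 - s i * D t i) / (s i.+1 - s i))).
    rewrite E_ext mulr_sumr.
    apply: is_derive_sum => i.
    have iN := ltn_ord i.
    have d1 := dq t i t0 (ltnW iN).
    have d2 := dq t i.+1 t0 iN.
    apply: is_derive_eq.
    by rewrite /GRing.scale/=; ring.
  rewrite /P; apply: is_derive_eq.
  by rewrite /GRing.scale/=; ring.
have cP : {within `[0, T], continuous P}.
  move=> t; apply: continuousB.
    apply: continuous_subspaceT => {}t; rewrite E_ext.
    elim/big_ind : _ => [|f g cf cg|i _]; first exact: cst_continuous.
      exact: continuousD.
    have iN := ltn_ord i.
    have c1 : {for t, continuous (q ^~ i.+1 \- q ^~ i)}.
      by apply: continuousB; apply: cq => //; exact: ltnW.
    rewrite (_ : _ *: _ = cst (2 / (s i.+1 - s i)) \*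
        ((q ^~ i.+1 \- q ^~ i) \* (q ^~ i.+1 \- q ^~ i))).
      by do 2 (apply: continuousM => //); exact: cst_continuous.
    by apply/funext => r; rewrite !fctE expr2.
  apply: continuousM; first by apply: continuous_subspaceT; exact: cst_continuous.
  apply: continuousD.
    by apply: parameterized_integral_continuous => //; exact: iB.
  by apply: continuous_subspaceT => {}t; apply: continuousM => //; exact: cst_continuous.
have : P T <= P 0.
  apply: (@ler0_derive1_le_cc _ P 0 T) => //; rewrite ?in_itv/= ?lexx ?T0//.
    by move=> t /[!in_itv]/= /andP[t0 _]; have [] := dP t t0.
  move=> t /[!in_itv]/= /andP[t0 tT]; rewrite derive1E.
  have /= -> := @derive_val _ _ _ _ _ _ _ (dP t t0).
  by rewrite -mulrBr pmulr_rle0// subr_le0; apply: DB; rewrite t0.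
rewrite /P /b set_itv1 Rintegral_set1 mulr0 addr0 mulr0 subr0.
by rewrite lerBlDr.
Qed.

(** * From grids to weighted norms *)

Section cumulative_integral.
Variable R : realType.
Notation mu := (@lebesgue_measure R).
Implicit Types (p : R -> R) (a b x : R).

Definition cumint p x : R := \int[mu]_(y in `]0, x]) p y.

Lemma cumint0 p : cumint p 0 = 0.
Proof. by rewrite /cumint set_itv_ge ?Rintegral_set0// bnd_simp ltxx. Qed.

Lemma cumintB p a b : mu.-integrable setT (EFin \o p) -> 0 <= a -> a <= b ->
  cumint p b - cumint p a = \int[mu]_(y in `]a, b]) p y.
Proof.
move=> ip a0 ab; apply: Rintegral_itvB; rewrite ?bnd_simp//.
exact: integrableS ip.
Qed.

Lemma cumint_le p x : mu.-integrable setT (EFin \o p) ->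
  cumint (Num.norm \o p) x <= \int[mu]_y `|p y|.
Proof.
move=> /integrable_norm ip; rewrite /cumint /Rintegral fine_le//.
- by apply: integrable_fin_num => //; apply: integrableS ip.
- exact: integrable_fin_num.
apply: ge0_subset_integral => //; first by case/integrableP : ip.
by move=> y _; rewrite lee_fin /=.
Qed.

Lemma norm_cumintB p a b : mu.-integrable setT (EFin \o p) -> 0 <= a -> a <= b ->
  `|cumint p b - cumint p a| <= cumint (Num.norm \o p) b - cumint (Num.norm \o p) a.
Proof.
move=> ip a0 ab; rewrite !cumintB//; last exact: integrable_norm.
by apply: le_normr_Rintegral => //; exact: integrableS ip.
Qed.

Lemma cumint_norm_le p a b : mu.-integrable setT (EFin \o p) -> 0 <= a -> a <= b ->
  cumint (Num.norm \o p) a <= cumint (Num.norm \o p) b.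
Proof.
move=> ip a0 ab; rewrite -subr_ge0 cumintB//; last exact: integrable_norm.
by apply: Rintegral_ge0 => y _ /=; exact: normr_ge0.
Qed.

Lemma norm_cumint_le p x : mu.-integrable setT (EFin \o p) -> 0 <= x ->
  `|cumint p x| <= \int[mu]_y `|p y|.
Proof.
move=> ip x0; have := norm_cumintB ip (lexx 0) x0.
rewrite !cumint0 !subr0 => /le_trans; apply; exact: cumint_le.
Qed.

Lemma integrable_powR_mul (q : R) p a b : 0 <= q -> 0 <= a ->
  mu.-integrable setT (EFin \o p) ->
  mu.-integrable `]a, b] (EFin \o (fun y => y `^ q * p y)).
Proof.
move=> q0 a0 ip; suff : mu.-integrable `]a, b]
  ((EFin \o (fun y : R => y `^ q)%R) \* (EFin \o p))%E by [].
apply: integrableMr => //.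
- exact: measurable_funTS (measurable_powR q).
- exists (b `^ q); split; first exact: num_real.
  move=> M bM y; rewrite /= in_itv/= => /andP[ay yb].
  rewrite ger0_norm ?powR_ge0// (le_trans _ (ltW bM))//.
  have y0 : 0 <= y by rewrite (le_trans a0)// ltW.
  by rewrite ge0_ler_powR// nnegrE// (le_trans y0).
- exact: integrableS ip.
Qed.

(** The weight [y^q] varies by at most [b^q - a^q] over the cell. This is the error made in
    [discrete_dissipation] when [D i - D i.+1] is replaced by [a i (m i.+1 - m i)]. *)
Lemma weighted_cumintB (q : R) p a b : 0 <= q -> 0 <= a -> a <= b ->
  mu.-integrable setT (EFin \o p) ->
  `|\int[mu]_(y in `]a, b]) (y `^ q * p y) - a `^ q * (cumint p b - cumint p a)|
    <= (b `^ q - a `^ q) * (cumint (Num.norm \o p) b - cumint (Num.norm \o p) a).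
Proof.
move=> q0 a0 ab ip.
have ipab : mu.-integrable `]a, b] (EFin \o p) by exact: integrableS ip.
have iapab c : mu.-integrable `]a, b] (EFin \o (fun y => c * p y)).
  exact: integrableZl ipab.
have inab : mu.-integrable `]a, b] (EFin \o (Num.norm \o p)) by exact: integrable_norm.
have ir := integrable_powR_mul b q0 a0 ip.
have inp := integrable_norm ip.
rewrite (cumintB ip a0 ab) (cumintB inp a0 ab).
rewrite -!RintegralZl//= -RintegralB//.
have ir' : mu.-integrable `]a, b] (EFin \o (fun y => y `^ q * p y - a `^ q * p y)).
  exact: (integrableB _ ir (iapab _)).
apply: (le_trans (le_normr_Rintegral _ ir')) => //.
apply: le_Rintegral => //.
- exact: integrable_norm ir'.
- exact: (integrableZl _ (b `^ q - a `^ q) inab).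
move=> y; rewrite /= in_itv/= => /andP[ay yb].
have y0 : 0 <= y by rewrite (le_trans a0)// ltW.
rewrite -mulrBl normrM ler_wpM2r//.
rewrite ger0_norm; first by rewrite lerB// ge0_ler_powR// nnegrE// (le_trans a0).
by rewrite subr_ge0 ge0_ler_powR// ?nnegrE// ltW.
Qed.

Lemma integrable_id a b : mu.-integrable `]a, b] (EFin \o (fun y => y)).
Proof.
apply: measurable_bounded_integrable => //.
  suff : (mu `]a, b] < +oo)%E by [].
  by rewrite lebesgue_measure_itv/=; case: ifPn => _; rewrite ltry.
exists (`|a| + `|b|); split; first exact: num_real.
move=> M abM y; rewrite /= in_itv/= => /andP[ay yb].
apply: le_trans (ltW abM); rewrite ler_norml opprD.
have := ler_norm b; have := ler_norm (- a); rewrite normrN => ha hb.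
by have := normr_ge0 a; have := normr_ge0 b => hb0 ha0; apply/andP; split; lra.
Qed.

Lemma integral_id a b : a <= b ->
  (\int[mu]_(y in `]a, b]) y%:E = ((b ^+ 2 - a ^+ 2) / 2)%:E)%E.
Proof.
rewrite le_eqVlt => /predU1P[<-|ab].
  by rewrite set_itv_ge ?bnd_simp ?ltxx// integral_set0 subrr mul0r.
rewrite integral_itv_obnd_cbnd; last exact/measurable_EFinP/measurable_id.
pose F (y : R) : R := 2^-1 * (y * y).
have dF (x : R) : is_derive x 1 F x.
  rewrite /F; apply: is_derive_eq; rewrite /GRing.scale/=; lra.
have cF : continuous F.
  by move=> y; apply/differentiable_continuous/derivable1_diffP; have [] := dF y.
rewrite (@continuous_FTC2 _ (fun y => y) F)//.
- by rewrite -EFinB /F; congr EFin; lra.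
- by apply: continuous_subspaceT => x; exact: cvg_id.
- split => //.
  + by apply: cvg_at_right_filter; exact: cF.
  + by apply: cvg_at_left_filter; exact: cF.
- by move=> x _; rewrite derive1E derive_val.
Qed.

Lemma measurable_inv_gt0 : measurable_fun `](0 : R), +oo[ (@GRing.inv R).
Proof.
apply: (@eq_measurable_fun _ _ _ _ _ (fun y => y `^ (-1))).
  by move=> y /[!inE]/=; rewrite in_itv/= andbT => y0; rewrite powR_inv1// ltW.
exact: measurable_funTS (measurable_powR _).
Qed.

(** The weight [y] has integral [(b^2 - a^2) / 2] over the cell. The bound comes from integrating
    [2 c p - c^2 y <= p^2 / y], that is [(p - c y)^2 / y >= 0], with the optimal constant [c]. *)
Lemma cell_Cauchy_Schwarz p a b : 0 <= a -> a < b ->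
  mu.-integrable setT (EFin \o p) ->
  ((2 * (\int[mu]_(y in `]a, b]) p y) ^+ 2 / (b ^+ 2 - a ^+ 2))%:E <=
    \int[mu]_(y in `]a, b]) (p y ^+ 2 / y)%:E)%E.
Proof.
move=> a0 ab ip.
have ipab : mu.-integrable `]a, b] (EFin \o p) by exact: integrableS ip.
have mpab : measurable_fun `]a, b] p by case/integrableP : ipab => /measurable_EFinP.
have [->|] := eqVneq (\int[mu]_(y in `]a, b]) (p y ^+ 2 / y)%:E)%E +oo%E.
  by rewrite leey.
rewrite -ltey => fin.
have y0 y : [set` `]a, b]] y -> 0 < y.
  by rewrite /= in_itv/= => /andP[ay _]; exact: le_lt_trans ay.
have msq : measurable_fun `]a, b] (fun y => p y ^+ 2 / y).
  apply: measurable_funM; first exact: measurable_funX.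
  apply: measurable_funS measurable_inv_gt0 => // y /y0.
  by rewrite /= in_itv/= andbT.
have isq : mu.-integrable `]a, b] (EFin \o (fun y => p y ^+ 2 / y)).
  apply/integrableP; split; first exact/measurable_EFinP.
  apply: le_lt_trans fin; rewrite le_eqVlt; apply/orP; left; apply/eqP.
  apply: eq_integral => y /[!inE] yab.
  by rewrite /= ger0_norm// divr_ge0 ?sqr_ge0// ltW// y0.
have d0 : 0 < b ^+ 2 - a ^+ 2.
  by rewrite subr_gt0 ltr_pXn2r// nnegrE// (le_trans a0)// ltW.
pose c := 2 * (\int[mu]_(y in `]a, b]) p y) / (b ^+ 2 - a ^+ 2).
have iid := integrable_id a b.
have ilin : mu.-integrable `]a, b] (EFin \o (fun y => 2 * c * p y - c ^+ 2 * y)).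
  exact: (integrableB _ (integrableZl _ _ ipab) (integrableZl _ _ iid)).
have -> : 2 * (\int[mu]_(y in `]a, b]) p y) ^+ 2 / (b ^+ 2 - a ^+ 2) =
    \int[mu]_(y in `]a, b]) (2 * c * p y - c ^+ 2 * y).
  rewrite RintegralB//; last 2 first.
    exact: (integrableZl _ _ ipab).
    exact: (integrableZl _ _ iid).
  rewrite !RintegralZl// {3}/Rintegral integral_id 1?ltW//= /c.
  by field; rewrite gt_eqF.
rewrite /Rintegral fineK; last exact: integrable_fin_num.
apply: le_integral => // y /[!inE] yab.
have {yab} := y0 y yab => y0'.
rewrite /= lee_fin -subr_ge0.
rewrite [leRHS](_ : _ = (p y - c * y) ^+ 2 / y); last by field; rewrite gt_eqF.
by rewrite divr_ge0 ?sqr_ge0// ltW.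
Qed.

Lemma ge0_integral_itv_sum (f : R -> \bar R) (x : nat -> R) N :
  measurable_fun `]x 0%N, +oo[ f -> (forall y, x 0%N < y -> (0 <= f y)%E) ->
  (forall i, (i < N)%N -> x i <= x i.+1) ->
  (\sum_(i < N) \int[mu]_(y in `]x i, x i.+1]) f y =
   \int[mu]_(y in `]x 0%N, x N]) f y)%E.
Proof.
move=> mf f0 xS.
suff [] : (\sum_(i < N) \int[mu]_(y in `]x i, x i.+1]) f y =
   \int[mu]_(y in `]x 0%N, x N]) f y)%E /\ x 0%N <= x N by [].
elim: N xS => [|N ih] xS.
  by rewrite big_ord0 set_itv_ge ?bnd_simp ?ltxx// integral_set0.
have [|{}ih x0N] := ih; first by move=> i iN; apply: xS; exact: ltnW.
have xNN := xS N (ltnSn _).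
split; last exact: le_trans xNN.
rewrite big_ord_recr/= ih -ge0_integral_setU//=.
- by rewrite -itv_bndbnd_setU// bnd_simp.
- rewrite -itv_bndbnd_setU ?bnd_simp//.
  by apply: measurable_funS mf => //; exact: subset_itvl.
- move=> y [|]; rewrite /= in_itv/= => /andP[+ _]; first exact: f0.
  by move=> xy; apply: f0; exact: le_lt_trans xy.
- apply/disj_setPS => y [/=]; rewrite 2!in_itv/= => /andP[_ yx] /andP[xy _].
  by move: yx; rewrite leNgt xy.
Qed.

End cumulative_integral.

(** * Recovering the weighted norm by Lebesgue differentiation along grids *)

Section grid_differentiation.
Variable R : realType.
Notation mu := (@lebesgue_measure R).

Lemma le_limn_einf (u v : (\bar R)^nat) : (forall k, u k <= v k)%E ->
  (limn_einf u <= limn_einf v)%E.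
Proof.
move=> uv; rewrite !limn_einf_lim; apply: lee_lim; try exact: is_cvg_einfs.
apply: nearW => n; apply: le_ereal_inf_tmp => _ [m /= nm <-].
by apply: ge_ereal_inf; exists (u m) => //; exists m.
Qed.

(** The cell of the grid of mesh [eta] that contains [x]; the ceiling locates it because cells are
    open on the left, as in [cumint]. *)
Definition grid_cell (eta x : R) : set R :=
  `]((Num.ceil (x / eta) - 1)%:~R * eta), ((Num.ceil (x / eta))%:~R * eta)].

Lemma grid_cell_mem (eta x : R) : 0 < eta -> grid_cell eta x x.
Proof.
move=> e0; have /andP[h1 h2] := ceil_itv (x / eta).
rewrite /grid_cell/= in_itv/= -ltr_pdivlMr// h1.
by rewrite -ler_pdivrMr.
Qed.

Lemma grid_cell_width (eta x : R) :
  (Num.ceil (x / eta))%:~R * eta = (Num.ceil (x / eta) - 1)%:~R * eta + eta.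
Proof. by rewrite intrB mulrBl mul1r subrK. Qed.

Lemma grid_cell_nicely_shrinking (eta : nat -> R) (x : R) :
  (forall k, 0 < eta k) -> eta @ \oo --> 0 ->
  nicely_shrinking x (fun k => grid_cell (eta k) x).
Proof.
move=> e0 ecvg; split; first by move=> k; exact: measurable_itv.
have e20 k : 0 < 2 * eta k by rewrite mulr_gt0.
(* The cell has length [eta] and lies in the ball of radius [2 eta] about [x], whose measure is
   [4 eta]. *)
exists (4, fun k => PosNum (e20 k)); split => //=.
- by rewrite -[X in _ --> X](mulr0 2); apply: cvgM => //; exact: cvg_cst.
- move=> k y; have := grid_cell_mem x (e0 k); rewrite /grid_cell/= !in_itv/=.
  rewrite !grid_cell_width ball_itv/= in_itv/=.
  set z := _%:~R * eta k; have ek := e0 k => /andP[zx xz] /andP[zy yz].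
  by apply/andP; split; lra.
- move=> k; rewrite lebesgue_measure_ball; last exact: ltW.
  rewrite /grid_cell lebesgue_measure_itv/= grid_cell_width lte_fin ltrDl e0.
  rewrite -EFinB -EFinM lee_fin mulr2n; lra.
Qed.

Lemma gridE (eta x : R) : 0 < eta -> 0 < x ->
  exists j : nat, Num.ceil (x / eta) = j.+1%:Z.
Proof.
move=> e0 x0; have : 0 < Num.ceil (x / eta) by rewrite ceil_gt0 divr_gt0.
by case: (Num.ceil _) => [[|j]|j]// _; exists j.
Qed.

(* The left-hand sides are the integrals of the squares of the averages of
   [p y / y] over the cells of the grid; these averages converge almost
   everywhere by Lebesgue differentiation. *)
Lemma grid_energy_liminf (p : R -> R) (N : nat -> nat) (eta e : nat -> R)
    (C : R) :
  mu.-integrable setT (EFin \o p) ->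
  (forall k, 0 < eta k) -> eta @ \oo --> 0 ->
  (fun k => (N k)%:R * eta k) @ \oo --> +oo -> e @ \oo --> 0 ->
  (forall k, \sum_(i < N k)
     2 * (cumint p (i.+1%:R * eta k) - cumint p (i%:R * eta k)) ^+ 2
       / ((i.+1%:R * eta k) ^+ 2 - (i%:R * eta k) ^+ 2) <= C + e k) ->
  (\int[mu]_(y in `]0%R, +oo[) (p y ^+ 2 / y)%:E <= C%:E)%E.
Proof.
move=> ip eta0 eta_cvg Ncvg ecvg HC.
pose x k i : R := i%:R * eta k.
pose c k i := 2 * (cumint p (x k i.+1) - cumint p (x k i))
                / (x k i.+1 ^+ 2 - x k i ^+ 2).
pose f k i (y : R) := (y * c k i ^+ 2)%:E.
pose A k i := [set` `]x k i, x k i.+1]].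
pose F k y := (\sum_(i < N k) (f k i \_ (A k i)) y)%E.
have x_ge0 k i : 0 <= x k i by rewrite mulr_ge0// ltW.
have xS k i : x k i < x k i.+1 by rewrite ltr_pM2r// ltr_nat.
have AD k i : A k i `<=` `]0, +oo[.
  move=> y; rewrite /A/= !in_itv/= andbT => /andP[+ _].
  exact: le_lt_trans.
have mf k i : measurable_fun setT (f k i).
  by apply/measurable_EFinP; apply: measurable_funM.
have mfA k i : measurable_fun `](0:R), +oo[ (f k i \_ (A k i)).
  apply/measurable_restrict => //; first exact: measurable_itv.
  by apply: measurable_funTS; exact: mf.
have f0 k i y : `](0:R), +oo[%classic y -> (0 <= (f k i \_ (A k i)) y)%E.
  move=> y0; rewrite patchE; case: ifPn => // _; rewrite lee_fin mulr_ge0 ?sqr_ge0//.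
  by move: y0; rewrite /= in_itv/= andbT => /ltW.
have F0 k y : `](0:R), +oo[%classic y -> (0 <= F k y)%E.
  by move=> y0; apply: sume_ge0 => i _; exact: f0.
have mF k : measurable_fun `](0:R), +oo[ (F k) by exact: emeasurable_sum.
have intF k : (\int[mu]_(y in `]0%R, +oo[) F k y <= (C + e k)%:E)%E.
  rewrite /F ge0_integral_sum//; last 2 first.
  - by move=> i; exact: mfA.
  - by move=> i y; exact: f0.
  have /= := HC k; rewrite -lee_fin; apply: le_trans.
  rewrite -sumEFin; apply: lee_sum => i _.
  rewrite -integral_mkcondr setIidr; last exact: AD.
  rewrite /f; under eq_integral do rewrite EFinM.
  rewrite ge0_integralZr//; last 3 first.
  - exact: measurable_itv.
  - by move=> y /AD; rewrite /= in_itv/= andbT lee_fin => /ltW.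
  - by rewrite lee_fin sqr_ge0.
  rewrite (integral_id (ltW (xS _ _))) -EFinM lee_fin le_eqVlt; apply/orP; left; apply/eqP.
  rewrite /c -/(x k _) -/(x k _); field.
  by rewrite subr_eq0 gt_eqF// ltr_pXn2r ?nnegrE.
have ae_p : {ae mu, forall y, lebesgue_pt p y}.
  apply: lebesgue_differentiation.
  have := integrable_locally measurableT ip.
  by rewrite patch_setT.
(* [F k] equals [y c^2] on each cell and its integral is the energy of the grid. Fatou reduces the
   claim to [p^2 / y <= liminf F] almost everywhere. *)
apply: (@le_trans _ _ (\int[mu]_(y in `]0%R, +oo[) limn_einf (F ^~ y))%E).
  apply: ae_ge0_le_integral => //.
  - move=> y; rewrite /= in_itv/= andbT => y0.
    by rewrite lee_fin divr_ge0 ?sqr_ge0// ltW.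
  - apply/measurable_EFinP/measurable_funM; last exact: measurable_inv_gt0.
    by apply/measurable_funX/measurable_funTS; case/integrableP : ip => /measurable_EFinP.
  - move=> y y0; rewrite -(cvg_limn_einf_sup (cvg_cst (0 : \bar R))).1.
    by apply: le_limn_einf => k; exact: F0.
  - apply: measurableT_comp => //; apply: measurable_fun_limn_esup => k.
    by apply: measurableT_comp => //; exact: mF.
  - move: ae_p; apply: filterS; first exact: (ae_filter_ringOfSetsType mu).
    move=> y yp /=; rewrite in_itv/= andbT => y0.
    pose j k : nat := `|Num.ceil (y / eta k)|.-1%N.
    have jE k : Num.ceil (y / eta k) = (j k).+1%:Z.
      by rewrite /j; have [n ->] := gridE (eta0 k) y0.
    have cellE k : grid_cell (eta k) y = A k (j k).
      rewrite /grid_cell jE; suff -> : (j k).+1%:Z - 1 = (j k)%:Z by [].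
      by rewrite -addn1 PoszD addrK.
    have memA k : A k (j k) y by rewrite -cellE; exact: grid_cell_mem.
    have Ew k : x k (j k).+1 = x k (j k) + eta k by rewrite /x -natr1 mulrDl mul1r.
    have locp : locally_integrable [set: R] p.
      by have := integrable_locally measurableT ip; rewrite patch_setT.
    have := nice_lebesgue_differentiation
      (fun z => grid_cell_nicely_shrinking z eta0 eta_cvg) locp yp.
    rewrite (_ : (fun _ => _) = (fun k =>
       ((cumint p (x k (j k).+1) - cumint p (x k (j k))) / eta k)%:E)); last first.
      apply/funext => k; rewrite cellE /A lebesgue_measure_itv/= lte_fin xS.
      rewrite cumintB//; last exact/ltW.
      rewrite -EFinB Ew addrAC subrr add0r inver gt_eqF// mulrC EFinM.
      congr (_ * _)%E; rewrite /Rintegral fineK//; apply: integrable_fin_num => //.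
      exact: integrableS ip.
    move/fine_cvgP => [_ /= dcvg].
    have xj_cvg : x k (j k) @[k --> \oo] --> y.
      apply: (@squeeze_cvgr _ _ _ _ (fun k => y - eta k) (cst y)).
      - apply: nearW => k; have := memA k; rewrite /A/= in_itv/= Ew => /andP[h1 h2].
        by apply/andP; split; [lra|exact: ltW].
      - by rewrite -[X in _ --> X]subr0; apply: cvgB => //; exact: cvg_cst.
      - exact: cvg_cst.
    have xjS_cvg : x k (j k).+1 @[k --> \oo] --> y.
      rewrite (_ : (fun _ => _) = (fun k => x k (j k) + eta k)); last first.
        by apply/funext => k; rewrite Ew.
      by rewrite -[X in _ --> X]addr0; exact: cvgD.
    have ccvg : y * c k (j k) ^+ 2 @[k --> \oo] --> p y ^+ 2 / y.
      (* Since [b^2 - a^2 = eta (b + a)] on a cell []a, b]], the constant [c] is twice the average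
         of [p] divided by [b + a], which tends to [p y / y]. *)
      rewrite (_ : (fun _ => _) = (fun k => y * (2 *
        ((cumint p (x k (j k).+1) - cumint p (x k (j k))) / eta k)
        * (x k (j k).+1 + x k (j k))^-1) ^+ 2)); last first.
        apply/funext => k; rewrite /c; congr (_ * _ ^+ 2).
        rewrite subr_sqr Ew; field.
        have xj0 := x_ge0 k (j k); have ek := eta0 k.
        by apply/andP; split; rewrite gt_eqF//; lra.
      have -> : p y ^+ 2 / y = y * (2 * p y * (y + y)^-1) ^+ 2.
        by field; rewrite -mulr2n mulrn_eq0/= gt_eqF.
      apply: cvgM; first exact: cvg_cst.
      have h : (2 *
        ((cumint p (x k (j k).+1) - cumint p (x k (j k))) / eta k)
        * (x k (j k).+1 + x k (j k))^-1) @[k --> \oo] --> 2 * p y * (y + y)^-1.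
        apply: cvgM; first by apply: cvgM => //; exact: cvg_cst.
        by apply: cvgV; [rewrite gt_eqF// addr_gt0|exact: cvgD].
      by rewrite expr2; under eq_fun do rewrite expr2; exact: cvgM.
    (* The grid may fail to reach [y] for small [k], where 0 is still a lower bound of [F]; it does
       reach [y] eventually, as [N k * eta k] tends to infinity. *)
    pose v k := if (j k < N k)%N then (y * c k (j k) ^+ 2)%:E else 0%E.
    have vcvg : v @ \oo --> (p y ^+ 2 / y)%:E.
      apply: (@cvg_trans _ ((y * c k (j k) ^+ 2)%:E @[k --> \oo])); last first.
        by apply: cvg_EFin => //; exact: nearW.
      apply: near_eq_cvg; near=> k; rewrite /v ifT//.
      have : y <= (N k)%:R * eta k by near: k; move/cvgryPge : Ncvg; exact.
      have := memA k; rewrite /A/= in_itv/= /x => /andP[h1 _] h2.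
      by have := lt_le_trans h1 h2; rewrite ltr_pM2r// ltr_nat.
    rewrite -(cvg_limn_einf_sup vcvg).1; apply: le_limn_einf => k.
    rewrite /v /F; case: ifPn => jN; last by apply: F0; rewrite /= in_itv/= andbT.
    rewrite (bigD1 (Ordinal jN))//= {1}patchE ifT ?inE// leeDl//.
    by apply: sume_ge0 => i _; apply: f0; rewrite /= in_itv/= andbT.
apply: (le_trans (fatou _ _ _ _)) => //.
have Ce : (C + e k)%:E @[k --> \oo] --> C%:E.
  apply: cvg_EFin; first exact: nearW.
  by rewrite -[X in _ --> X]addr0; apply: cvgD => //; exact: cvg_cst.
rewrite -(cvg_limn_einf_sup Ce).1; exact: le_limn_einf.
Unshelve. all: by end_near.
Qed.

End grid_differentiation.

(** * Increments of power functions *)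

Section powR_increments.
Variable R : realType.

(** Mean value theorem, the factor [a] being absorbed by [a c^(q - 1) <= c^q]. This factor
    compensates the derivative of [x^q], unbounded near 0 when [0 < q < 1]. *)
Lemma powR_increment (q a b n : R) : 0 <= q -> 0 <= a -> a <= b -> b <= n ->
  a * (b `^ q - a `^ q) <= q * n `^ q * (b - a).
Proof.
move=> q0; rewrite le_eqVlt => /predU1P[<- b0 _|a0].
  by rewrite mul0r !mulr_ge0 ?powR_ge0 ?subr_ge0.
rewrite le_eqVlt => /predU1P[<- _|ab bn]; first by rewrite !subrr !mulr0.
move: q0; rewrite le_eqVlt => /predU1P[<-|q0].
  by rewrite !powRr0 subrr mulr0 !mul0r.
have dp (x : R) : x \in `[a, b] -> is_derive x 1 ((@powR R)^~ q) (q * x `^ (q - 1)).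
  rewrite in_itv/= => /andP[ax _]; apply: is_derive1_powR; exact: lt_le_trans ax.
have cq : {within `[a, b], continuous ((@powR R)^~ q)}.
  by apply: derivable_within_continuous => y yab; have [] := dp _ yab.
have dp' (x : R) : x \in `]a, b[ ->
    is_derive x 1 ((@powR R)^~ q) (q * x `^ (q - 1)).
  by move=> xab; apply: dp; exact: subset_itv_oo_cc xab.
have [c + E] := @MVT R ((@powR R)^~ q) (fun x => q * x `^ (q - 1)) a b ab dp' cq.
rewrite in_itv/= => /andP[ac cb]; rewrite {}E.
have c0 : 0 < c by exact: lt_trans ac.
rewrite [leLHS](_ : _ = q * (a * c `^ (q - 1)) * (b - a)); last by ring.
apply: ler_wpM2r; first by rewrite subr_ge0 ltW.
apply: ler_wpM2l; first exact: ltW.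
rewrite (@le_trans _ _ (c * c `^ (q - 1)))//.
  by rewrite ler_wpM2r ?powR_ge0// ltW.
rewrite (mulr_powRB1 (ltW c0) q0) ge0_ler_powR ?nnegrE ?(ltW q0)//.
- exact: ltW.
- by rewrite (le_trans _ bn)// ltW// (lt_trans c0).
- by rewrite (le_trans _ bn)// ltW.
Qed.

(** An increment larger than [e] forces [b] above [del = e^(1/q)], hence [a] above [del / 2], where
    [powR_increment] contradicts it. The two terms of the minimum serve these two steps. *)
Lemma powR_unif_continuous (q n e : R) : 0 <= q -> 0 < e ->
  exists2 d, 0 < d & forall a b, 0 <= a -> a <= b -> b <= n -> b - a < d ->
    b `^ q - a `^ q <= e.
Proof.
move=> q0 e0.
have [->|qneq0] := eqVneq q 0.
  by exists 1 => // a b _ _ _ _; rewrite !powRr0 subrr ltW.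
have qgt0 : 0 < q by rewrite lt_def qneq0.
pose del := e `^ q^-1.
have del0 : 0 < del by exact: powR_gt0.
have delq : del `^ q = e by rewrite -powRrM mulVf// powRr1// ltW.
pose K := q * n `^ q.
have K0 : 0 <= K by rewrite mulr_ge0// powR_ge0.
have K1 : 0 < K + 1 by rewrite ltr_wpDl.
exists (Num.min (del / 2) (e * del / 2 / (K + 1))).
  by rewrite lt_min !divr_gt0// mulr_gt0.
move=> a b a0 ab bn; rewrite lt_min => /andP[d1 d2].
rewrite leNgt; apply/negP => eab.
have delb : del < b.
  rewrite ltNge; apply/negP => bdel.
  have : b `^ q <= e.
    by rewrite -delq ge0_ler_powR// nnegrE; [exact: le_trans ab|exact: ltW].
  by have := powR_ge0 a q; lra.
have da : del / 2 < a by lra.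
have := powR_increment q0 a0 ab bn; rewrite -/K.
apply/negP; rewrite -ltNge.
have h1 : K * (b - a) <= (K + 1) * (b - a).
  by rewrite ler_wpM2r ?subr_ge0// lerDl.
have h2 : (K + 1) * (b - a) < e * del / 2 by rewrite mulrC -ltr_pdivlMr.
have h3 : e * del / 2 < a * (b `^ q - a `^ q).
  rewrite -mulrA mulrC; apply: ltr_pM => //; last exact: ltW.
  by rewrite divr_ge0// ltW.
lra.
Qed.

End powR_increments.

(** * Continuous curves in L^1 *)

Section continuous_curve.
Variable R : realType.
Notation mu := (@lebesgue_measure R).
Variable p : R -> R -> R.
Hypothesis ip : forall t, mu.-integrable setT (EFin \o p t).
Hypothesis cp : forall t0 : R,
  (\int[mu]_y `|p t y - p t0 y|) @[t --> t0] --> 0.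

Let ipB t s : mu.-integrable setT (EFin \o (fun y => p t y - p s y)).
Proof. exact: (integrableB _ (ip t) (ip s)). Qed.

Lemma curve_cumint_dist t s x :
  0 <= x -> `|cumint (p t) x - cumint (p s) x| <= \int[mu]_y `|p t y - p s y|.
Proof.
move=> x0; rewrite /cumint -RintegralB//; try exact: integrableS (ip _).
exact: (norm_cumint_le (ipB t s)).
Qed.

Lemma curve_cumint_continuous x : 0 <= x -> continuous (fun t => cumint (p t) x).
Proof.
move=> x0 t0; apply/subr_cvg0.
apply: (@norm_cvg0 _ R^o); apply: (squeeze_cvgr _ (cvg_cst 0) (@cp t0)).
by apply: nearW => t; rewrite normr_ge0 curve_cumint_dist.
Qed.

Lemma curve_bounded T : exists2 W : R, 0 <= W &
  forall t, 0 <= t <= T -> \int[mu]_y `|p t y| <= W.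
Proof.
have [T0|T0] := leP 0 T; last first.
  by exists 0 => // t /andP[t0 tT]; have := le_lt_trans (le_trans t0 tT) T0;
    rewrite ltxx.
have cN : continuous (fun t => \int[mu]_y `|p t y|).
  move=> t0; apply/subr_cvg0.
  apply: (@norm_cvg0 _ R^o); apply: (squeeze_cvgr _ (cvg_cst 0) (@cp t0)).
  apply: nearW => t; rewrite normr_ge0/= -RintegralB//; try exact: integrable_norm.
  have i2 : mu.-integrable setT (EFin \o (fun y => `|p t y| - `|p t0 y|)).
    exact: (integrableB _ (integrable_norm (ip t)) (integrable_norm (ip t0))).
  apply: (le_trans (le_normr_Rintegral _ i2)) => //.
  apply: le_Rintegral => //.
  - exact: integrable_norm i2.
  - exact: integrable_norm (ipB _ _).
  - by move=> y _; exact: ler_dist_dist.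
have [c cT Hc] := EVT_max T0 (continuous_subspaceT cN).
exists (\int[mu]_y `|p c y|); first exact: Rintegral_ge0.
by move=> t tT; apply: Hc; rewrite in_itv.
Qed.

(** Each [|p t0|] has an absolutely continuous integral, and nearby times are close in L^1;
    compactness of [[0, T]] makes the width uniform in time. *)
Lemma curve_equi_integrable T e : 0 < e ->
  exists2 d : R, 0 < d & forall t a b, 0 <= t <= T -> 0 <= a -> a <= b -> b - a < d ->
    cumint (Num.norm \o p t) b - cumint (Num.norm \o p t) a <= e.
Proof.
move=> e0; have e20 : 0 < e / 2 by rewrite divr_gt0.
pose P (d t : R) := forall a b, 0 <= a -> a <= b -> b - a < d ->
    cumint (Num.norm \o p t) b - cumint (Num.norm \o p t) a <= e.
have /compact_near_coveringP := @segment_compact R 0 T.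
move=> /(_ R (0^'+) P _)[].
  move=> t0 _.
  have [d [d0 Hd]] := integral_normr_continuous (ip t0) e20.
  exists ([set t | \int[mu]_y `|p t y - p t0 y| < e / 2], [set d' | d' < d]).
    split => /=.
      have := @cp t0; move/cvgrPdist_lt => /(_ _ e20).
      apply: filterS => t; rewrite sub0r normrN ger0_norm//.
      exact: Rintegral_ge0.
    exact: nbhs_right_lt.
  move=> [t d']/= [tt0 d'd] a b a0 ab bad.
  rewrite cumintB//; last exact: integrable_norm.
  have muab : (mu `]a, b] < d%:E)%E.
    rewrite lebesgue_measure_itv/=; case: ifPn => _; last by rewrite lte_fin.
    by rewrite -EFinB lte_fin (lt_trans bad).
  have ht0 : \int[mu]_(y in `]a, b]) `|p t0 y| < e / 2.
    by apply: Hd muab; exact: measurable_itv.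
  have iab s : mu.-integrable `]a, b] (EFin \o (fun y => `|p s y|)).
    by apply: integrableS (integrable_norm (ip s)).
  have iab' : mu.-integrable `]a, b] (EFin \o (fun y => `|p t y - p t0 y|)).
    by apply: integrableS (integrable_norm (ipB t t0)).
  have : \int[mu]_(y in `]a, b]) `|p t y| <=
     \int[mu]_(y in `]a, b]) (`|p t y - p t0 y| + `|p t0 y|).
    apply: le_Rintegral => //; first exact: (integrableD _ iab' (iab t0)).
    by move=> y _; rewrite -lerBlDr lerB_dist.
  rewrite RintegralD// => h1.
  have h2 : \int[mu]_(y in `]a, b]) `|p t y - p t0 y| <= \int[mu]_y `|p t y - p t0 y|.
    have := cumint_le b (ipB t t0).
    apply: le_trans; rewrite -(cumintB (p := fun y => `|p t y - p t0 y|))//; last first.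
      exact: integrable_norm (ipB t t0).
    rewrite gerBl//; exact: Rintegral_ge0.
  rewrite (le_trans h1)// [leRHS]splitr lerD//; last exact: ltW.
  by rewrite (le_trans h2)// ltW.
move=> d d0 Hd; exists (d / 2); first by rewrite divr_gt0.
move=> t a b tT; apply: (Hd (d / 2)) => //=.
- by rewrite sub0r normrN ger0_norm ?divr_ge0 1?ltW// ltr_pdivrMr// ltr_pMr ?ltr1n.
- by rewrite divr_gt0.
Qed.

End continuous_curve.

(** * Contraction of the weighted norm along an abstract curve *)

Section contraction.
Variable R : realType.
Notation mu := (@lebesgue_measure R).

Lemma grid_energy_le (p : R -> R) (N : nat) (eta C : R) : 0 < eta ->
  mu.-integrable setT (EFin \o p) ->
  (\int[mu]_(y in `]0%R, +oo[) (p y ^+ 2 / y)%:E <= C%:E)%E ->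
  \sum_(i < N) 2 * (cumint p (i.+1%:R * eta) - cumint p (i%:R * eta)) ^+ 2
       / ((i.+1%:R * eta) ^+ 2 - (i%:R * eta) ^+ 2) <= C.
Proof.
move=> eta0 ip pC; rewrite -lee_fin -sumEFin.
have mp2 : measurable_fun `](0:R), +oo[ (fun y => (p y ^+ 2 / y)%:E).
  apply/measurable_EFinP/measurable_funM; last exact: measurable_inv_gt0.
  by apply/measurable_funX/measurable_funTS; case/integrableP : ip => /measurable_EFinP.
have x_ge0 (i : nat) : 0 <= i%:R * eta by rewrite mulr_ge0// ltW.
have xS (i : nat) : i%:R * eta < i.+1%:R * eta by rewrite ltr_pM2r// ltr_nat.
have p20 y : 0 < y -> (0 <= (p y ^+ 2 / y)%:E)%E.
  by move=> y0; rewrite lee_fin divr_ge0 ?sqr_ge0// ltW.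
apply: le_trans pC.
have h : (\int[mu]_(y in `](0%:R * eta)%R, (N%:R * eta)%R]) (p y ^+ 2 / y)%:E <=
    \int[mu]_(y in `]0%R, +oo[) (p y ^+ 2 / y)%:E)%E.
  apply: ge0_subset_integral => //.
    by move=> y; rewrite /= in_itv/= andbT; exact: p20.
  by rewrite mul0r; exact: subset_itvl.
apply: le_trans h.
rewrite -(ge0_integral_itv_sum (x := fun i => i%:R * eta))/= ?mul0r//.
  apply: lee_sum => i _; rewrite (cumintB ip (x_ge0 _) (ltW (xS _))).
  exact: cell_Cauchy_Schwarz.
by move=> i _; exact/ltW.
Qed.

(** Here [p t] stands for the density of mass of the deviation and [q] for [gamma - 2]. Hypothesis
    [dp] is the equation for the mass below [x] corrected at [n]; in [tailp], stated further on, the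
    exponent [q + 2] is [gamma]. *)
Variables (q T : R) (p : R -> R -> R).
Hypothesis q0 : 0 <= q.
Hypothesis T0 : 0 < T.
Hypothesis ip : forall t, mu.-integrable setT (EFin \o p t).
Hypothesis cp : forall t0 : R,
  (\int[mu]_y `|p t y - p t0 y|) @[t --> t0] --> 0.
Hypothesis dp : forall n x t : R, 0 < n -> 0 <= x -> x <= n -> 0 < t ->
  is_derive t 1 (fun r => cumint (p r) x - x ^+ 2 / n ^+ 2 * cumint (p r) n)
    (x ^+ 2 * \int[mu]_(y in `]x, n]) (y `^ q * p t y)).

(* [W] bounds the mass of [|p|] on [0, T]; the second summand of the error is
   what is lost by cutting at [n]. *)
Lemma grid_energy_growth (n eta delta W : R) (N : nat) :
  0 < n -> N%:R * eta = n -> (0 < N)%N -> 0 <= delta -> 0 <= W ->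
  (forall t, 0 <= t <= T -> \int[mu]_y `|p t y| <= W) ->
  (forall a b, 0 <= a -> a <= b -> b <= n -> b - a <= eta -> b `^ q - a `^ q <= delta) ->
  (forall t a b, 0 <= t <= T -> 0 <= a -> a <= b -> b - a <= eta ->
    cumint (Num.norm \o p t) b - cumint (Num.norm \o p t) a <= delta) ->
  \sum_(i < N) 2 * (cumint (p T) (i.+1%:R * eta) - cumint (p T) (i%:R * eta)) ^+ 2
       / ((i.+1%:R * eta) ^+ 2 - (i%:R * eta) ^+ 2) <=
  \sum_(i < N) 2 * (cumint (p 0) (i.+1%:R * eta) - cumint (p 0) (i%:R * eta)) ^+ 2
       / ((i.+1%:R * eta) ^+ 2 - (i%:R * eta) ^+ 2)
  + 2 * W ^+ 2 / n ^+ 2 + 2 * n `^ q * W * \int[mu]_(r in `[0, T]) `|cumint (p r) n|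
  + 4 * ((W * delta + q * n `^ q * delta) * W) * T.
Proof.
move=> n0 Nn N0 d0 W0 HW Ha HV.
have eta0 : 0 < eta by move: n0; rewrite -Nn pmulr_rgt0// ltr0n.
pose x (i : nat) : R := i%:R * eta.
pose s (i : nat) : R := x i ^+ 2.
pose m t i := cumint (p t) (x i).
pose a i := x i `^ q.
pose D t i := \int[mu]_(y in `]x i, n]) (y `^ q * p t y).
pose V t i := cumint (Num.norm \o p t) (x i.+1) - cumint (Num.norm \o p t) (x i).
have xN : x N = n by [].
have x0 i : 0 <= x i by rewrite mulr_ge0// ltW.
have xS i : x i < x i.+1 by rewrite ltr_pM2r// ltr_nat.
have dx i : x i.+1 - x i = eta by rewrite /x -mulrBl -natrB// subSnn mul1r.
have xle i : (i <= N)%N -> x i <= n.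
  by move=> iN; rewrite -xN ler_pM2r// ler_nat.
have sS i : s i < s i.+1 by rewrite /s ltr_pXn2r// nnegrE.
have s0 : s 0%N = 0 by rewrite /s /x mul0r expr0n.
have m0 t : m t 0%N = 0 by rewrite /m /x mul0r cumint0.
have sN : s N != 0 by rewrite /s xN expf_neq0// gt_eqF.
have sN0 : 0 < s N by rewrite lt_def sN sqr_ge0.
have cm (y : R) : 0 <= y -> continuous (fun t => cumint (p t) y).
  by move=> y0; exact: curve_cumint_continuous.
have E t := @discrete_energy_split _ N s (m t) s0 (m0 t) sN (fun i _ => sS i).
pose B t := a N * m t N ^+ 2 / 2.
have cB : continuous B.
  move=> t; rewrite /B; apply: cvgM; last exact: cvg_cst.
  apply: cvgM; first exact: cvg_cst.
  by rewrite expr2; under eq_fun do rewrite expr2; apply: cvgM; apply: cm.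
have mW t y : 0 <= t <= T -> 0 <= y -> `|cumint (p t) y| <= W.
  by move=> tT y0; apply: le_trans (HW _ tT); exact: norm_cumint_le.
have iB (f : R -> R) : continuous f -> mu.-integrable `[0, T] (EFin \o f).
  move=> cf; apply: continuous_compact_integrable; first exact: segment_compact.
  exact: continuous_subspaceT.
have Hc i : (i <= N)%N -> continuous (fun t => m t i - s i / s N * m t N).
  move=> iN t; apply: cvgB; first exact: cm.
  by apply: cvgM; [exact: cvg_cst|apply: cm].
have Hd (t : R) i : 0 < t -> (i <= N)%N ->
    is_derive t 1 (fun r => m r i - s i / s N * m r N) (s i * D t i).
  by move=> t0 iN; rewrite /m /s xN; apply: dp => //; exact: xle.
have Hdis t : 0 < t < T ->
    \sum_(i < N) ((m t i.+1 - s i.+1 / s N * m t N) - (m t i - s i / s N * m t N))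
      * (s i.+1 * D t i.+1 - s i * D t i) / (s i.+1 - s i) <=
    B t + (W * delta + q * n `^ q * delta) * W.
  move=> /andP[t0 tT]; have tT' : 0 <= t <= T by rewrite !ltW.
  apply: (@discrete_dissipation _ N s a (m t) (D t) (V t)) => //.
  - by rewrite /D xN set_itv_ge ?Rintegral_set0// bnd_simp ltxx.
  - exact: powR_ge0.
  - by rewrite mulr_ge0// powR_ge0.
  - by move=> i _; rewrite ge0_ler_powR ?nnegrE// ltW.
  - move=> i iN; rewrite subr_ge0 cumint_norm_le ?(ltW (xS i))//=.
    by rewrite HV ?(ltW (xS i)) ?dx.
  - by move=> i iN; rewrite norm_cumintB// ltW.
  - move=> i iN; have -> : D t i - D t i.+1 =
        \int[mu]_(y in `]x i, x i.+1]) (y `^ q * p t y).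
      rewrite /D -(@Rintegral_itvB _ _ (BRight (x i)) (BRight n) (x i.+1)).
      - by rewrite opprB addrC subrK.
      - exact: integrable_powR_mul.
      - by rewrite bnd_simp ltW.
      - by rewrite bnd_simp xle.
    by apply: weighted_cumintB => //; exact: ltW.
  - by move=> i iN; exact: mW.
  - by move=> i iN; rewrite Ha ?dx ?xle// ltW.
  - move=> i iN; rewrite /s /a.
    have h := powR_increment q0 (x0 i) (ltW (xS i)) (xle i.+1 iN).
    rewrite expr2 -mulrA (le_trans (ler_wpM2l (x0 i) h))//.
    rewrite [leLHS](_ : _ = q * n `^ q * ((x i.+1 - x i) * x i)); last by ring.
    rewrite subr_sqr ler_wpM2l ?mulr_ge0 ?powR_ge0// ler_wpM2l ?lerDr//.
    by rewrite dx ltW.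
  - rewrite /V; have tel : \sum_(i < N) (cumint (Num.norm \o p t) (x i.+1)
        - cumint (Num.norm \o p t) (x i)) = cumint (Num.norm \o p t) (x N)
        - cumint (Num.norm \o p t) (x 0%N).
      by rewrite -(telescope_sumr (fun i => cumint (Num.norm \o p t) (x i)))// big_mkord.
    rewrite tel /x mul0r cumint0 subr0 (le_trans _ (HW _ tT'))//.
    exact: cumint_le.
have := @discrete_energy_growth R N s (fun t i => m t i - s i / s N * m t N) D B T
  ((W * delta + q * n `^ q * delta) * W) (ltW T0) cB Hc Hd Hdis.
(* Only one of the two factors [cumint (p r) n] is bounded by [W]; the other is kept because [tailp]
   makes its time integral small. *)
have intB : \int[mu]_(r in `[0, T]) B r <=
    n `^ q * W / 2 * \int[mu]_(r in `[0, T]) `|cumint (p r) n|.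
  have cmn : continuous (fun t => `|cumint (p t) n|).
    by move=> t; apply: cvg_norm; apply: cm; exact: ltW.
  rewrite -RintegralZl//; last exact: iB cmn.
  apply: le_Rintegral => //; first exact: iB cB.
    by apply: iB => t; apply: cvgM; [exact: cvg_cst|exact: cmn].
  move=> t; rewrite /= in_itv/= => tT.
  rewrite /B /a /m xN [leRHS]mulrAC ler_pM2r ?invr_gt0// -mulrA ler_wpM2l ?powR_ge0//.
  rewrite -(ger0_norm (sqr_ge0 (cumint _ _))) normrX expr2.
  by rewrite ler_wpM2r// mW// ltW.
have mT : m T N ^+ 2 <= W ^+ 2.
  rewrite -[X in X <= _]ger0_norm ?sqr_ge0// normrX ler_pXn2r ?nnegrE//.
  by rewrite mW ?(ltW T0) ?lexx.
have mTn : 2 * m T N ^+ 2 / s N <= 2 * W ^+ 2 / n ^+ 2.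
  by rewrite /s xN ler_pM2r ?invr_gt0 ?exprn_gt0// ler_pM2l.
have m0n : 0 <= 2 * m 0 N ^+ 2 / s N.
  by rewrite divr_ge0 ?(ltW sN0)// mulr_ge0 ?sqr_ge0.
pose En t := \sum_(i < N) 2 * (m t i.+1 - m t i) ^+ 2 / (s i.+1 - s i).
(* By [E] both energies are exchanged for the corrected ones. The extra term costs [2 W^2 / n^2] at
   time [T] and has the favourable sign at time 0. *)
move=> grow; rewrite -[X in X <= _]/(En T) -[X in _ <= X + _ + _ + _]/(En 0) /En !E.
move: grow intB mTn m0n; lra.
Qed.

Hypothesis tailp : exists C : R, forall n, 0 < n ->
  n `^ (q + 2) * \int[mu]_(r in `[0, T]) `|cumint (p r) n| <= C.

(** Take [n = k + 1]. By [tailp] the cut at [n] costs [O(n^-2)], and the mesh, chosen after [n],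
    brings the discretization error down to [O(1 / n)], with constants that do not depend on [k]. *)
Lemma grid_energy_small : forall C0 : R,
  (\int[mu]_(y in `]0%R, +oo[) (p 0 y ^+ 2 / y)%:E <= C0%:E)%E ->
  exists A : R, forall k : nat, exists N : nat,
    [/\ (0 < N)%N, k.+1%:R / N%:R <= k.+1%:R^-1 :> R &
    forall eta, eta = k.+1%:R / N%:R ->
    \sum_(i < N) 2 * (cumint (p T) (i.+1%:R * eta) - cumint (p T) (i%:R * eta)) ^+ 2
       / ((i.+1%:R * eta) ^+ 2 - (i%:R * eta) ^+ 2) <= C0 + A / k.+1%:R].
Proof.
move=> C0 pC0; have [W W0 HW] := curve_bounded ip cp T.
have [Ct HCt] := tailp.
exists (2 * W ^+ 2 + 2 * W * `|Ct| + 4 * T) => k.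
set n : R := k.+1%:R; have n0 : 0 < n by rewrite ltr0n.
have n1 : 1 <= n by rewrite ler1n.
(* Up to the factor [4 T], the discretization error is [K * delta], at most [1 / n] for this
   [delta]; adding 1 to [K] covers [K = 0]. *)
pose K := (W + q * n `^ q) * W.
have K0 : 0 <= K by rewrite mulr_ge0// addr_ge0// mulr_ge0// powR_ge0.
pose delta := (n * (K + 1))^-1.
have delta0 : 0 < delta by rewrite invr_gt0 mulr_gt0// ltr_wpDl.
have [d1 d10 Hd1] := powR_unif_continuous n q0 delta0.
have [d2 d20 Hd2] := curve_equi_integrable ip cp T delta0.
(* The term [n^-1] sends the mesh to 0 as [n] grows, as Lebesgue differentiation requires. *)
pose d := Num.min n^-1 (Num.min d1 d2).
have d0 : 0 < d by rewrite !lt_min d10 d20 invr_gt0 n0.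
pose N := (Num.truncn (n / d)).+1.
have N0 : 0 < N%:R :> R by rewrite ltr0n.
have nN : n / N%:R < d.
  by rewrite ltr_pdivrMr// mulrC -ltr_pdivrMr// truncnS_gt.
have [nNn nN1 nN2] : [/\ n / N%:R <= n^-1, n / N%:R < d1 & n / N%:R < d2].
  by move: nN; rewrite !lt_min => /andP[h1 /andP[h2 h3]]; split => //; exact: ltW.
exists N; split => // eta etaE.
have NetaE : N%:R * eta = n by rewrite etaE mulrC divfK// gt_eqF.
have eta0 : 0 < eta by rewrite etaE divr_gt0.
have := @grid_energy_growth n eta delta W N n0 NetaE isT (ltW delta0) W0 HW _ _.
set S := \sum_(i < N) _; set S0 := \sum_(i < N) _ => grow.
have S0C : S0 <= C0 by exact: grid_energy_le.
have {}grow : S <= S0 + 2 * W ^+ 2 / n ^+ 2 + 2 * n `^ q * W *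
    \int[mu]_(r in `[0, T]) `|cumint (p r) n|
    + 4 * ((W * delta + q * n `^ q * delta) * W) * T.
  apply: grow.
    move=> a b a0 ab bn abeta; apply: Hd1 => //; rewrite (le_lt_trans abeta)//.
    by rewrite etaE.
  move=> t a b tT a0 ab abeta; apply: Hd2 => //; rewrite (le_lt_trans abeta)//.
  by rewrite etaE.
set I := \int[mu]_(r in `[0, T]) _ in grow.
have nnn : n^-1 ^+ 2 <= n^-1 by rewrite expr2 ler_piMr ?invr_ge0 ?(ltW n0)// invf_le1.
have h1 : 2 * W ^+ 2 / n ^+ 2 <= 2 * W ^+ 2 * n^-1.
  by rewrite -exprVn ler_wpM2l// mulr_ge0 ?sqr_ge0.
have h2 : 2 * n `^ q * W * I <= 2 * W * `|Ct| * n^-1.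
  rewrite [leLHS](_ : _ = 2 * W * (n `^ q * I)); last by ring.
  rewrite -[leRHS]mulrA; apply: ler_wpM2l; first by rewrite mulr_ge0.
  have n2 : n `^ (q + 2) = n `^ q * n ^+ 2.
    by rewrite powRD ?(gt_eqF n0) ?implybT// -(powR_mulrn 2 (ltW n0)).
  have := HCt n n0; rewrite -/I n2 => h.
  have {}h : n `^ q * I <= Ct * n^-1 ^+ 2.
    by rewrite exprVn ler_pdivlMr ?exprn_gt0// mulrAC.
  rewrite (le_trans h)// (@le_trans _ _ (`|Ct| * n^-1 ^+ 2))//.
    by rewrite ler_wpM2r ?sqr_ge0// ler_norm.
  by rewrite ler_wpM2l.
have h3 : 4 * ((W * delta + q * n `^ q * delta) * W) * T <= 4 * T * n^-1.
  rewrite [leLHS](_ : _ = 4 * T * (K * delta)); last by rewrite /K; ring.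
  rewrite ler_wpM2l ?mulr_ge0 ?(ltW T0)//.
  rewrite /delta invfM mulrCA ler_piMr ?invr_ge0 ?(ltW n0)//.
  by rewrite ler_pdivrMr ?mul1r ?lerDl// ltr_wpDl.
by rewrite (le_trans grow)// (mulrDl _ _ n^-1) (mulrDl _ _ n^-1) !addrA !lerD.
Qed.

Lemma weighted_L2_contraction :
  (\int[mu]_(y in `]0%R, +oo[) (p T y ^+ 2 / y)%:E <=
   \int[mu]_(y in `]0%R, +oo[) (p 0 y ^+ 2 / y)%:E)%E.
Proof.
set I0 := (X in (_ <= X)%E).
have I00 : (0 <= I0)%E.
  apply: integral_ge0 => y; rewrite /= in_itv/= andbT => y0.
  by rewrite lee_fin divr_ge0 ?sqr_ge0// ltW.
have [->|] := eqVneq I0 +oo%E; first by rewrite leey.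
rewrite -ltey -ge0_fin_numE// => /fineK I0E.
have := @grid_energy_small (fine I0); rewrite I0E => /(_ (lexx _))[A HA].
have [N HN] := choice HA; rewrite -I0E.
have n0 k : 0 < (N k)%:R :> R by have [+ _ _] := HN k; rewrite ltr0n.
apply: (@grid_energy_liminf _ _ N (fun k => k.+1%:R / (N k)%:R)
  (fun k => A / k.+1%:R)) => //.
- by move=> k; rewrite divr_gt0.
- apply: (squeeze_cvgr _ (cvg_cst 0) cvg_harmonic).
  apply: nearW => k; have [_ h _] := HN k; rewrite h andbT.
  by rewrite divr_ge0.
- rewrite (_ : (fun _ => _) = (fun k => k.+1%:R)).
    by apply/cvgryPge => B; near=> k; rewrite (@le_trans _ _ k%:R) ?ler_nat//;
      near: k; exact: nbhs_infty_ger.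
  by apply/funext => k; rewrite mulrC divfK// gt_eqF.
- rewrite -[X in _ --> X](mulr0 A); apply: cvgM; first exact: cvg_cst.
  exact: cvg_harmonic.
- by move=> k; have [_ _] := HN k; exact.
Unshelve. all: by end_near. Qed.

End contraction.

(** * Dilations of Lebesgue integrals *)

Section dilation.
Variable R : realType.
Notation mu := (@lebesgue_measure R).

(** [mu] is [c] times its image under the inverse dilation's preimages,
    [mu A = c * mu {y | c y in A}]: this is checked on the intervals []a, b]] and extended by
    uniqueness of Lebesgue measure. *)
Lemma ge0_integral_dilation (c : R) (D : set R) (f : R -> \bar R) : 0 < c ->
  measurable D -> measurable_fun D f -> (forall y, D y -> 0 <= f y)%E ->
  (\int[mu]_(y in D) f y = c%:E * \int[mu]_(y in *%R c @^-1` D) f (c * y)%R)%E.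
Proof.
move=> c0 mD mf f0.
have mc : measurable_fun setT ( *%R c : measurableTypeR R -> measurableTypeR R).
  exact: mulrl_measurable.
pose M := measure_function_pushforward__canonical__measure_function_Measure mu mc.
have muM A : measurable A -> mu A = mscale (NngNum (ltW c0)) M A.
  move=> mA; apply: lebesgue_measure_unique mA => _ [[a b]] _ <-.
  rewrite -[RHS]/(c%:E * mu ( *%R c @^-1` `]a, b]))%E.
  rewrite (_ : *%R c @^-1` _ = `](c^-1 * a), (c^-1 * b)]%classic).
    rewrite !lebesgue_measure_itv/= !lte_fin ltr_pM2l ?invr_gt0//.
    case: ifPn => _; last by rewrite mule0.
    by rewrite -!EFinB -EFinM -mulrBr mulrA divff ?gt_eqF// mul1r.
  by apply/seteqP; split => y /=; rewrite !in_itv/= ltr_pdivrMl// ler_pdivlMl.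
have <- : (\int[M]_(y in D) f y = \int[mu]_(y in *%R c @^-1` D) f (c * y)%R)%E.
  apply: (ge0_integral_pushforward mc mu mD mf).
  by move=> y /[!inE]; exact: f0.
rewrite -(@ge0_integral_mscale _ _ R M D mD (NngNum (ltW c0)) f)//.
by apply: eq_measure_integral => A mA _; exact: muM.
Qed.

Lemma preimage_dilation_oo (c : R) : 0 < c -> *%R c @^-1` `]0, +oo[ = `]0, +oo[%classic.
Proof.
by move=> c0; apply/seteqP; split => y; rewrite /= !in_itv/= !andbT pmulr_rgt0.
Qed.

Lemma preimage_dilation_oc (c a b : R) : 0 < c ->
  *%R c @^-1` `](c * a), (c * b)] = `]a, b]%classic.
Proof.
by move=> c0; apply/seteqP; split => y; rewrite /= !in_itv/= ltr_pM2l// ler_pM2l.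
Qed.

End dilation.

(** * The steady state *)

Section weighted_density.
Variable R : realType.
Notation mu := (@lebesgue_measure R).

(* The density of mass, extended by 0: an isometry of L^1(x dx) into L^1(R). *)
Definition mdens (u : R -> R) : R -> R := (fun y => y * u y) \_ `]0, +oo[.

Lemma mdensE (u : R -> R) y : 0 < y -> mdens u y = y * u y.
Proof. by move=> y0; rewrite /mdens patchE mem_set//= in_itv/= y0. Qed.

Lemma mdens0 (u : R -> R) y : y <= 0 -> mdens u y = 0.
Proof.
move=> y0; rewrite /mdens patchE memNset//= in_itv/= andbT.
by apply/negP; rewrite -leNgt.
Qed.

Lemma measurable_mdens (u : R -> R) : measurable_fun `](0:R), +oo[ u ->
  measurable_fun setT (mdens u).
Proof.
move=> mu_; apply/(measurable_restrictT _ _).1 => //.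
by apply: measurable_funM.
Qed.

Lemma L1normE (u : R -> R) : L1norm (@wmass R) u = (\int[mu]_y (`|mdens u y|)%:E)%E.
Proof.
rewrite /L1norm integral_mkcond; apply: eq_integral => y _.
rewrite /mdens/= !patchE; case: ifPn => [|_]; last by rewrite normr0.
by rewrite inE/= in_itv/= andbT /wmass normrM => y0; rewrite gtr0_norm.
Qed.

Lemma inL1_integrable (u : R -> R) : inL1 (@wmass R) u ->
  mu.-integrable setT (EFin \o mdens u).
Proof.
move=> [mu_ uoo]; apply/integrableP; split.
  by apply/measurable_EFinP; exact: measurable_mdens.
by rewrite -L1normE.
Qed.

Lemma massE (u : R -> R) : mass u = \int[mu]_y mdens u y.
Proof. by rewrite /mass Rintegral_mkcond. Qed.

Lemma cumint_mass (u : R -> R) (n : R) : inL1 (@wmass R) u -> 0 <= n ->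
  mass u - cumint (mdens u) n = \int[mu]_(y in `]n, +oo[) mdens u y.
Proof.
move=> /inL1_integrable hu n0; rewrite /mass.
rewrite (@eq_Rintegral _ _ _ mu `]0, +oo[ (mdens u)); last first.
  by move=> y; rewrite inE/= in_itv/= andbT => y0; rewrite mdensE.
rewrite -(@Rintegral_itvB _ _ (BRight 0) +oo%O n)//.
exact: integrableS hu.
Qed.

End weighted_density.

(** * First integral, monotonicity and tail of the steady state *)

Section steady.
Variable R : realType.
Notation mu := (@lebesgue_measure R).
Variables (gamma : R) (G : R -> R).
Hypothesis gamma2 : 2 <= gamma.
Hypothesis hG : steady_state gamma G.

Let G_gt0 (x : R) : 0 < x -> 0 < G x. Proof. by have [+ _ _ _ _] := hG; exact. Qed.
Let G_L1 : inL1 (@wmass R) G. Proof. by case: hG. Qed.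
Let gamma0 : 0 < gamma. Proof. exact: lt_le_trans gamma2. Qed.

Let J (x : R) : R := \int[mu]_(y in `]x, +oo[) (y `^ (gamma - 1) * G y).

Let J_integrable (x : R) : 0 < x ->
  mu.-integrable `]x, +oo[ (EFin \o (fun y => y `^ (gamma - 1) * G y)).
Proof.
move=> x0; have [_ _ _ + _] := hG => /(_ x x0) h.
apply: eq_integrable (integrableZl _ (2^-1) h) => //=.
by move=> y _; rewrite /fragb -EFinM; congr EFin; field.
Qed.

Let h (y : R) := y * G y.

Let h_derivable (x : R) : 0 < x -> derivable h x 1.
Proof. by move=> x0; have [_ _ _ _ /(_ x x0)[]] := hG. Qed.

Let h_derive1 (x : R) : 0 < x ->
  derive1 h x = gamma * (2 * J x - x `^ gamma * G x) - G x.
Proof.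
move=> x0; have [_ _ _ _ /(_ x x0)[_ E]] := hG.
apply/eqP; rewrite eq_sym subr_eq; apply/eqP; rewrite {}E /fragop /fragB.
congr (_ * (_ - _)); rewrite /J -RintegralZl//; last exact: J_integrable.
by apply: eq_Rintegral => y _; rewrite /fragb mulrA.
Qed.

Let G_continuous (x : R) : 0 < x -> {for x, continuous G}.
Proof.
move=> x0; have ch : {for x, continuous h}.
  exact/differentiable_continuous/derivable1_diffP/h_derivable.
have hG' z : 0 < z -> h z / z = G z by move=> z0; rewrite /h mulrAC divff ?gt_eqF// mul1r.
have : h y / y @[y --> x] --> h x / x.
  by apply: cvgM ch _; apply: cvgV; [rewrite gt_eqF|exact: cvg_id].
rewrite hG'//; apply: cvg_trans; apply: near_eq_cvg; near=> y.
have y0 : 0 < y by near: y; exact: lt_nbhsr.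
by rewrite hG'.
Unshelve. all: by end_near. Qed.

Let powR_continuous_gt0 (q x : R) : 0 < x -> {for x, continuous ((@powR R)^~ q)}.
Proof.
move=> x0; apply/differentiable_continuous/derivable1_diffP.
by have [] := @is_derive1_powR R q x x0.
Qed.

Let J_sub (x y : R) : 0 < x -> x <= y ->
  J x - J y = \int[mu]_(z in `]x, y]) (z `^ (gamma - 1) * G z).
Proof.
move=> x0 xy; rewrite /J.
rewrite -(@Rintegral_itvB _ _ (BRight x) +oo%O y)//; last exact: J_integrable.
by rewrite opprB addrC subrK.
Qed.

Let J_derive (x : R) : 0 < x -> is_derive x 1 J (- (x `^ (gamma - 1) * G x)).
Proof.
move=> x0; have x20 : 0 < x / 2 by rewrite divr_gt0.
have x2x : x / 2 < x by rewrite ltr_pdivrMr// ltr_pMr// ltr1n.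
pose F (y : R) := \int[mu]_(z in `]x / 2, y]) (z `^ (gamma - 1) * G z).
have [dF F'] : derivable F x 1 /\ derive1 F x = x `^ (gamma - 1) * G x.
  apply: (@continuous_FTC1 _ _ _ _ (x + 1)); rewrite ?bnd_simp ?ltrDl//.
    apply: integrableS (J_integrable x20) => //; exact: subset_itvl.
  by apply: cvgM; [exact: powR_continuous_gt0|exact: G_continuous].
have dF' : is_derive x 1 (fun y => J (x / 2) - F y) (- (x `^ (gamma - 1) * G x)).
  have FF : is_derive x 1 F (x `^ (gamma - 1) * G x).
    by rewrite -F' derive1E; exact/derivableP.
  by apply: is_derive_eq; rewrite add0r mul1r.
apply: near_eq_is_derive dF'.
near=> y; have yx : x / 2 < y by near: y; exact: lt_nbhsr.
by rewrite /F -J_sub// 1?ltW// opprB addrC subrK.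
Unshelve. all: by end_near. Qed.

(** Multiplied by [x], the steady equation is in divergence form: [x ((x G)' + G) = (x^2 G)'], and
    [x] times [fragop gamma G x] is [(x^2 J)']. Hence [Q = x^2 (G - gamma J)] is a first
    integral. *)
Let Q (x : R) := x * h x - gamma * (x ^+ 2 * J x).

Let Q_derive (x : R) : 0 < x -> is_derive x 1 Q 0.
Proof.
move=> x0; have dJ := J_derive x0.
have dh : is_derive x 1 h (gamma * (2 * J x - x `^ gamma * G x) - G x).
  by rewrite -h_derive1// derive1E; exact/derivableP/h_derivable.
rewrite /Q; apply: is_derive_eq; rewrite /GRing.scale/= /h.
rewrite -(mulr_powRB1 (ltW x0) gamma0); ring.
Qed.

Let Q_cst (x y : R) : 0 < x -> 0 < y -> Q x = Q y.
Proof.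
wlog xy : x y / x <= y.
  by move=> H x0 y0; have [/H|/ltW/H] := leP x y; [exact|move=> ->].
move=> x0 y0; apply/esym/eqP; rewrite -subr_eq0; apply/eqP.
have dQ z : z \in `[x, y]%R -> is_derive z 1 Q 0.
  by rewrite in_itv/= => /andP[xz _]; apply: Q_derive; exact: lt_le_trans xz.
have cQ : {within `[x, y], continuous Q}.
  by apply: derivable_within_continuous => z zxy; have [] := dQ _ zxy.
have dQ' z : z \in `]x, y[%R -> is_derive z 1 Q (cst 0 z).
  by move=> zxy; apply: dQ; exact: subset_itv_oo_cc zxy.
have [c _ ->] := @MVT_segment R Q (cst 0) x y xy dQ' cQ.
by rewrite mul0r.
Qed.

Let J_ge0 (x : R) : 0 < x -> 0 <= J x.
Proof.
move=> x0; apply: Rintegral_ge0 => y; rewrite /= in_itv/= andbT => xy.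
by rewrite mulr_ge0 ?powR_ge0// ltW// G_gt0// (lt_trans x0).
Qed.

Let G_mass_int := inL1_integrable G_L1.

Lemma steady_state_cumint_le1 (x : R) : 0 <= x -> cumint (mdens G) x <= 1.
Proof.
move=> x0; have [_ _ <- _ _] := hG.
rewrite -subr_ge0 cumint_mass//; apply: Rintegral_ge0 => y.
rewrite /= in_itv/= andbT => xy; have y0 := le_lt_trans x0 xy.
by rewrite mdensE// mulr_ge0// ltW// G_gt0.
Qed.

Lemma steady_state_cumint_nd (x y : R) : 0 <= x -> x <= y ->
  cumint (mdens G) x <= cumint (mdens G) y.
Proof.
move=> x0 xy; rewrite -subr_ge0 cumintB//; apply: Rintegral_ge0 => z.
rewrite /= in_itv/= => /andP[xz _]; have z0 := le_lt_trans x0 xz.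
by rewrite mdensE// mulr_ge0// ltW// G_gt0.
Qed.

Let cumint_part_le1 (x y : R) : 0 <= x -> x <= y ->
  \int[mu]_(z in `]x, y]) mdens G z <= 1.
Proof.
move=> x0 xy; rewrite -cumintB//.
have h1 := steady_state_cumint_le1 (le_trans x0 xy).
have h2 := steady_state_cumint_nd (lexx 0) x0; rewrite cumint0 in h2.
lra.
Qed.

(* The steady equation says that [x^2 (G - gamma J)] is constant, say [c].
   If [c > 0] then [x G >= c / x] is not integrable at 0; if [c < 0] then
   [J >= - c / (gamma x^2)], although [J <= J 1 + 1] near 0 because
   [y^(gamma - 1) <= y] for [y <= 1]. *)
Let Q_eq0 (x : R) : 0 < x -> Q x = 0.
Proof.
move=> x0; rewrite (Q_cst x0 ltr01); set c := Q 1.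
have Qc z : 0 < z -> z * (z * G z) = gamma * (z ^+ 2 * J z) + c.
  by move=> z0; rewrite /c (Q_cst ltr01 z0) /Q /h addrC subrK.
have [c0|c0|//] := ltgtP c 0.
- pose B := gamma * (J 1 + 1).
  have J1 := J_ge0 ltr01.
  have B0 : 0 < B by rewrite mulr_gt0// ltr_wpDl.
  (* Together with [J z <= J 1 + 1], this choice gives [gamma z^2 J z <= z B <= - c], against the
     positivity of [z^2 G z = gamma z^2 J z + c]. *)
  pose z := Num.min 1 (- c / B).
  have z0 : 0 < z by rewrite lt_min ltr01 divr_gt0// oppr_gt0.
  have z1 : z <= 1 by rewrite ge_min lexx.
  have zB : z * B <= - c by rewrite -ler_pdivlMr// ge_min lexx orbT.
  have Jz : J z <= J 1 + 1.
    rewrite -lerBlDl J_sub//; apply: le_trans (cumint_part_le1 (ltW z0) z1).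
    apply: le_Rintegral => //.
    - apply: integrableS (J_integrable z0) => //; exact: subset_itvl.
    - exact: integrableS G_mass_int.
    move=> y; rewrite /= in_itv/= => /andP[zy y1]; have y0 := lt_trans z0 zy.
    rewrite mdensE// ler_wpM2r ?(ltW (G_gt0 y0))// ge1r_powR ?y0//.
    by rewrite lerBrDr.
  have : 0 < z * (z * G z) by rewrite !mulr_gt0// G_gt0.
  have : gamma * (z ^+ 2 * J z) <= z * B.
    rewrite /B [leRHS]mulrCA ler_wpM2l ?(ltW gamma0)//.
    rewrite expr2 -mulrA ler_wpM2l ?(ltW z0)//.
    by rewrite (le_trans _ Jz)// ler_piMl// J_ge0.
  rewrite Qc//; lra.
- have c20 : 0 < c / 2 by rewrite divr_gt0.
  have [d [d0 Hd]] := integral_normr_continuous G_mass_int c20.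
  (* The interval []z, 2 z]] is shorter than [d], so it carries a mass less than [c / 2]; but there
     [y G y >= c / y >= c / (2 z)], and its length is [z]. *)
  pose z := d / 2; have z0 : 0 < z by rewrite divr_gt0.
  have zz : z <= 2 * z by lra.
  have muz : mu `]z, (2 * z)%R] = z%:E.
    rewrite lebesgue_measure_itv/= ifT; last by rewrite lte_fin; lra.
    by rewrite -EFinB; congr EFin; ring.
  have mz : (mu `]z, (2 * z)%R] < d%:E)%E by rewrite muz lte_fin /z; lra.
  have : \int[mu]_(y in `]z, 2 * z]) `|mdens G y| < c / 2.
    by apply: Hd mz; exact: measurable_itv.
  have : \int[mu]_(y in `]z, 2 * z]) (c / (2 * z)) <=
      \int[mu]_(y in `]z, 2 * z]) `|mdens G y|.
    apply: le_Rintegral => //.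
    + apply: measurable_bounded_integrable => //; first exact: lt_trans mz (ltry _).
      by apply/bounded_cst.
    + by apply: integrableS (integrable_norm G_mass_int).
    move=> y; rewrite /= in_itv/= => /andP[zy y2]; have y0 := lt_trans z0 zy.
    rewrite mdensE// gtr0_norm ?mulr_gt0 ?G_gt0//.
    have yy : c <= y * (y * G y) 
      by rewrite Qc// lerDr mulr_ge0 ?(ltW gamma0)// mulr_ge0 ?sqr_ge0 ?J_ge0.
    rewrite ler_pdivrMr ?mulr_gt0// (le_trans yy)// mulrC ler_wpM2l//.
    by rewrite mulr_ge0 ?(ltW y0)// ltW// G_gt0.
  have -> : \int[mu]_(y in `]z, 2 * z]) (c / (2 * z)) = c / (2 * z) * z.
    by rewrite Rintegral_cst//; exact: (congr1 (fun e : \bar R => c / (2 * z) * fine e) muz).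
  rewrite (_ : c / (2 * z) * z = c / 2); last by field; rewrite gt_eqF.
  by move=> h1 h2; have := le_lt_trans h1 h2; rewrite ltxx.
Qed.

Lemma steady_stateE (x : R) : 0 < x ->
  G x = gamma * \int[mu]_(y in `]x, +oo[) (y `^ (gamma - 1) * G y).
Proof.
move=> x0; have /eqP := Q_eq0 x0; rewrite subr_eq0 => /eqP Q0.
have xx : x * x != 0 by rewrite mulf_neq0// gt_eqF.
by apply: (mulfI xx); rewrite -/(J x) -mulrA Q0; ring.
Qed.

Lemma steady_state_increment (x y : R) : 0 < x -> x <= y ->
  \int[mu]_(z in `]x, y]) (z `^ (gamma - 1) * G z) = (G x - G y) / gamma.
Proof.
move=> x0 xy; rewrite -J_sub// (steady_stateE x0).
rewrite (steady_stateE (lt_le_trans x0 xy)) -/(J x) -/(J y).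
by rewrite -mulrBr mulrC mulKf// gt_eqF.
Qed.

Lemma steady_state_ni (x y : R) : 0 < x -> x <= y -> G y <= G x.
Proof.
move=> x0 xy; have : 0 <= (G x - G y) / gamma.
  rewrite -steady_state_increment//; apply: Rintegral_ge0 => z.
  rewrite /= in_itv/= => /andP[xz _].
  by rewrite mulr_ge0 ?powR_ge0// ltW// G_gt0// (lt_trans x0).
by rewrite pmulr_lge0 ?invr_gt0// subr_ge0.
Qed.

Lemma steady_state_cumint_derive (x : R) : 0 < x ->
  is_derive x 1 (cumint (mdens G)) (x * G x).
Proof.
move=> x0.
have [dF F'] : derivable (cumint (mdens G)) x 1 /\
    derive1 (cumint (mdens G)) x = mdens G x.
  apply: (@continuous_FTC1 _ _ _ _ (x + 1)); rewrite ?bnd_simp ?ltrDl//.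
    exact: integrableS G_mass_int.
  have ch : {for x, continuous h}.
    exact/differentiable_continuous/derivable1_diffP/h_derivable.
  move: ch; rewrite /prop_for /continuous_at mdensE//.
  apply: cvg_trans; apply: near_eq_cvg; near=> y.
  by rewrite mdensE//; near: y; exact: lt_nbhsr.
have : is_derive x 1 (cumint (mdens G)) (mdens G x).
  by rewrite -F' derive1E; exact/derivableP.
by rewrite (mdensE G x0).
Unshelve. all: by end_near. Qed.

(** For [y >= n], [n^(gamma - 2) y <= y^(gamma - 1)], so the left-hand side is at most
    [n^2 J n = n^2 G n / gamma]. As [G] is nonincreasing with mass 1, [n^2 G n <= 2], and
    [2 <= gamma] concludes. *)
Lemma steady_state_tail (n : R) : 0 < n ->
  n `^ gamma * (1 - cumint (mdens G) n) <= 1.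
Proof.
move=> n0; have [_ _ mG _ _] := hG.
have nG : n ^+ 2 * G n <= 2.
  have := cumint_part_le1 (lexx 0) (ltW n0).
  have : \int[mu]_(z in `]0, n]) (G n * z) <= \int[mu]_(z in `]0, n]) mdens G z.
    apply: le_Rintegral => //.
    + exact: (integrableZl _ _ (integrable_id 0 n)).
    + exact: integrableS G_mass_int.
    move=> z; rewrite /= in_itv/= => /andP[z0 zn].
    by rewrite mdensE// mulrC ler_wpM2l ?(ltW z0)// steady_state_ni.
  rewrite RintegralZl//; last exact: integrable_id.
  rewrite {1}/Rintegral (integral_id (ltW n0))/= expr0n subr0; lra.
have nq0 : n `^ (gamma - 2) != 0 by rewrite gt_eqF// powR_gt0.
have tailJ : n `^ (gamma - 2) * (1 - cumint (mdens G) n) <= J n.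
  rewrite -[X in _ * (X - cumint _ _)]mG (cumint_mass G_L1 (ltW n0)) -RintegralZl//; last first.
    exact: integrableS G_mass_int.
  rewrite /J; apply: le_Rintegral => //.
  + have inG : mu.-integrable `]n, +oo[ (EFin \o mdens G).
      exact: integrableS G_mass_int.
    exact: (integrableZl _ (n `^ (gamma - 2)) inG).
  + exact: J_integrable.
  move=> y; rewrite /= in_itv/= andbT => ny; have y0 := lt_trans n0 ny.
  rewrite mdensE// mulrA ler_wpM2r ?(ltW (G_gt0 _))//.
  have -> : y `^ (gamma - 1) = y `^ (gamma - 2) * y.
    have e : gamma - 1 = gamma - 2 + 1 by ring.
    by rewrite e (@powRD _ y (gamma - 2) 1) ?(gt_eqF y0) ?implybT// powRr1 ?(ltW y0).
  rewrite ler_wpM2r ?(ltW y0)// ge0_ler_powR ?nnegrE ?(ltW n0) ?(ltW y0) ?(ltW ny)//.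
  by rewrite subr_ge0.
have -> : n `^ gamma = n `^ (gamma - 2) * n ^+ 2.
  have e : gamma = gamma - 2 + 2 by ring.
  rewrite {1}e (@powRD _ n (gamma - 2) 2) ?(gt_eqF n0) ?implybT//.
  by rewrite -(powR_mulrn 2 (ltW n0)).
rewrite mulrAC.
have : n ^+ 2 * J n <= 1.
  rewrite -(ler_pM2l gamma0) mulrCA -steady_stateE// mulr1.
  exact: le_trans gamma2.
apply: le_trans; rewrite mulrC ler_wpM2l ?sqr_ge0//.
Qed.

End steady.

(** * The dilated steady state as a solution of the fragmentation equation *)

Section selfsimilar_steady.
Variable R : realType.
Notation mu := (@lebesgue_measure R).
Variables (gamma : R) (G : R -> R).
Hypothesis gamma2 : 2 <= gamma.
Hypothesis hG : steady_state gamma G.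

Let G_gt0 (x : R) : 0 < x -> 0 < G x. Proof. by have [+ _ _ _ _] := hG; exact. Qed.
Let G_L1 : inL1 (@wmass R) G. Proof. by case: hG. Qed.
Let gamma0 : 0 < gamma. Proof. exact: lt_le_trans gamma2. Qed.

Lemma mdens_steady_ge0 y : 0 <= mdens G y.
Proof.
have [y0|y0] := ltP 0 y; last by rewrite mdens0.
by rewrite mdensE// mulr_ge0// ltW// G_gt0.
Qed.

(* The density of mass of l^2 G(l y), which has the same mass as G. *)
Definition steady_dil (l y : R) : R := l * mdens G (l * y).

Let G_mass_int := inL1_integrable G_L1.

Let mG : measurable_fun setT (mdens G).
Proof. by have /integrableP[/measurable_EFinP] := G_mass_int. Qed.

Let measurable_dil (l : R) : measurable_fun setT (steady_dil l).
Proof.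
apply: measurable_funM => //; apply: (measurableT_comp mG).
exact: mulrl_measurable.
Qed.

Lemma steady_dil_ge0 l y : 0 < l -> 0 <= steady_dil l y.
Proof. by move=> l0; rewrite mulr_ge0 ?(ltW l0)// mdens_steady_ge0. Qed.

Let integral_dil (l : R) (D : set R) : 0 < l -> measurable D ->
  (\int[mu]_(y in D) (mdens G y)%:E =
   \int[mu]_(y in *%R l @^-1` D) (steady_dil l y)%:E)%E.
Proof.
move=> l0 mD; rewrite (@ge0_integral_dilation R l D (EFin \o mdens G))//; last 2 first.
- by apply/measurable_EFinP; exact: measurable_funTS.
- by move=> y _; rewrite lee_fin mdens_steady_ge0.
rewrite /steady_dil; under [RHS]eq_integral do rewrite EFinM.
rewrite ge0_integralZl//.
- rewrite -[X in measurable X]setTI; apply: mulrl_measurable => //.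
- apply/measurable_EFinP; apply: measurable_funTS; apply: (measurableT_comp mG).
  exact: mulrl_measurable.
- by move=> y _; rewrite lee_fin mdens_steady_ge0.
- by rewrite lee_fin ltW.
Qed.

Lemma integrable_steady_dil (l : R) : 0 < l ->
  mu.-integrable setT (EFin \o steady_dil l).
Proof.
move=> l0; apply/integrableP; split; first by apply/measurable_EFinP; exact: measurable_dil.
have -> : (\int[mu]_x `|(EFin \o steady_dil l) x| = \int[mu]_x (mdens G x)%:E)%E.
  rewrite (integral_dil l0)// preimage_setT.
  by apply: eq_integral => y _; rewrite /= ger0_norm// steady_dil_ge0.
have /integrableP[_] := G_mass_int; apply: le_lt_trans.
rewrite le_eqVlt; apply/orP; left; apply/eqP.
by apply: eq_integral => y _; rewrite /= ger0_norm// mdens_steady_ge0.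
Qed.

Lemma Rintegral_steady_dil (l : R) : 0 < l -> \int[mu]_y steady_dil l y = 1.
Proof.
move=> l0; have [_ _ <- _ _] := hG.
by rewrite massE /Rintegral (integral_dil l0)// preimage_setT.
Qed.

Lemma cumint_steady_dil (l x : R) : 0 < l ->
  cumint (steady_dil l) x = cumint (mdens G) (l * x).
Proof.
move=> l0; rewrite /cumint /Rintegral (integral_dil l0)//.
by rewrite -[in `]0, l * x]](mulr0 l) preimage_dilation_oc.
Qed.

(* [G] is nonincreasing, so that [l^2 G(l y)] dominates [m^2 G(l y)] and
   [m^2 G(m y)] dominates it too. *)
Let steady_dil_dist_le (l m : R) : 1 <= m -> m <= l ->
  \int[mu]_y `|steady_dil l y - steady_dil m y| <= 4 * (l - m).
Proof.
move=> m1 ml; have m0 : 0 < m by exact: lt_le_trans m1.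
have l0 : 0 < l by exact: lt_le_trans ml.
pose r := (m / l) ^+ 2.
have il := integrable_steady_dil l0; have im := integrable_steady_dil m0.
have ilm : mu.-integrable setT (EFin \o (fun y => steady_dil l y - steady_dil m y)).
  exact: (integrableB _ il im).
have irl : mu.-integrable setT (EFin \o (fun y => 2 * r * steady_dil l y)).
  exact: (integrableZl _ _ il).
have ilDm : mu.-integrable setT (EFin \o (fun y => steady_dil l y + steady_dil m y)).
  exact: (integrableD _ il im).
(* For positive [y], [r * steady_dil l y = m^2 y G(l y)] is a common lower bound, and
   [|a - b| <= a + b - 2 c] whenever [c <= a] and [c <= b]. As both masses are 1, the integral is
   [2 (1 - r)]. *)
apply: (@le_trans _ _ (\int[mu]_y (steady_dil l y + steady_dil m y
   - 2 * r * steady_dil l y))).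
  apply: le_Rintegral => //.
  - exact: integrable_norm ilm.
  - exact: (integrableB _ ilDm irl).
  move=> y _; have [y0|y0] := ltP 0 y; last first.
    rewrite /steady_dil !mdens0 ?pmulr_rle0//.
    by rewrite !mulr0 subr0 addr0 normr0 subr0.
  rewrite /steady_dil !mdensE ?mulr_gt0//.
  have Gml : G (l * y) <= G (m * y) by rewrite (steady_state_ni gamma2 hG) ?mulr_gt0// ler_pM2r.
  have ml2 : m * m <= l * l by rewrite ler_pM// ltW.
  have Gl0 := ltW (G_gt0 (mulr_gt0 l0 y0)).
  have -> : 2 * r * (l * (l * y * G (l * y))) = 2 * (m * m) * y * G (l * y).
    by rewrite /r; field; rewrite gt_eqF.
  have h1 : 0 <= y * (m * m) * (G (m * y) - G (l * y)).
    by rewrite mulr_ge0 ?subr_ge0// !mulr_ge0 ?(ltW y0) ?(ltW m0).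
  have h2 : 0 <= y * G (l * y) * (l * l - m * m).
    by rewrite mulr_ge0 ?subr_ge0// mulr_ge0// ltW.
  by rewrite ler_norml; apply/andP; split; lra.
rewrite RintegralB// RintegralD// RintegralZl// !Rintegral_steady_dil//.
have mlr : 0 <= m / l <= 1.
  by rewrite divr_ge0 ?(ltW m0) ?(ltW l0)//= ler_pdivrMr// mul1r.
have : 1 - m / l <= l - m.
  rewrite -[X in X - _](divff (lt0r_neq0 l0)) -mulrBl ler_pdivrMr//.
  by rewrite ler_peMr ?subr_ge0// (le_trans m1).
rewrite /r expr2; move: mlr => /andP[]; move: (m / l) => z z0 z1 h.
have : (1 - z) * (1 + z) <= (1 - z) * 2 by rewrite ler_wpM2l ?subr_ge0//; lra.
lra.
Qed.

Lemma steady_dil_dist (l m : R) : 1 <= l -> 1 <= m ->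
  \int[mu]_y `|steady_dil l y - steady_dil m y| <= 4 * `|l - m|.
Proof.
move=> l1 m1; have [ml|/ltW lm] := leP m l.
  by rewrite (ger0_norm (x := l - m)) ?subr_ge0// steady_dil_dist_le.
rewrite distrC (@eq_Rintegral _ _ _ mu _ (fun y => `|steady_dil m y - steady_dil l y|)).
  by rewrite (ger0_norm (x := m - l)) ?subr_ge0// steady_dil_dist_le.
by move=> y _; rewrite distrC.
Qed.

Lemma weighted_steady_dil (l x n : R) : 0 < l -> 0 < x -> x <= n ->
  \int[mu]_(y in `]x, n]) (y `^ (gamma - 2) * steady_dil l y) =
  l * l `^ (1 - gamma) * (G (l * x) - G (l * n)) / gamma.
Proof.
move=> l0 x0 xn.
have lx0 : 0 < l * x by rewrite mulr_gt0.
have lxn : l * x <= l * n by rewrite ler_pM2l.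
rewrite -mulrA -(steady_state_increment gamma2 hG lx0 lxn).
pose j (z : R) := z `^ (gamma - 1) * G z.
have ij : mu.-integrable `]l * x, l * n] (EFin \o j).
  have [_ _ _ /(_ _ lx0) ij _] := hG.
  apply: (@integrableS _ _ _ mu `](l * x), +oo[) => //; first exact: subset_itvl.
  apply: eq_integrable (integrableZl _ (2^-1) ij) => //=.
  by move=> y _; rewrite /fragb /j -EFinM; congr EFin; field.
rewrite /Rintegral (@ge0_integral_dilation R l `](l * x), (l * n)] (EFin \o j))//; last 2 first.
- by case/integrableP : ij.
- move=> y; rewrite /= in_itv/= => /andP[lxy _]; rewrite lee_fin mulr_ge0 ?powR_ge0//.
  by rewrite ltW// G_gt0// (lt_trans lx0).
rewrite preimage_dilation_oc//.
have E y : y \in `]x, n]%classic -> (y `^ (gamma - 2) * steady_dil l y)%:E =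
    ((l ^+ 2 * l `^ (1 - gamma))%:E * (EFin \o j) (l * y)%R)%E.
  rewrite inE/= in_itv/= => /andP[xy _]; have y0 := lt_trans x0 xy.
  rewrite /steady_dil mdensE ?mulr_gt0//= -EFinM /j; congr EFin.
  rewrite powRM ?(ltW l0) ?(ltW y0)//.
  have -> : y `^ (gamma - 1) = y `^ (gamma - 2) * y.
    have e : gamma - 1 = gamma - 2 + 1 by ring.
    by rewrite e (@powRD _ y (gamma - 2) 1) ?(gt_eqF y0) ?implybT// powRr1 ?(ltW y0).
  have l1 : l `^ (1 - gamma) * l `^ (gamma - 1) = 1.
    rewrite -powRD ?(gt_eqF l0) ?implybT//.
    by rewrite addrC addrA subrK subrr powRr0.
  transitivity (l ^+ 2 * (l `^ (1 - gamma) * l `^ (gamma - 1)) *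
    (y `^ (gamma - 2) * y * G (l * y))); last by ring.
  by rewrite l1; ring.
have -> : (\int[mu]_(y in `]x, n]) (y `^ (gamma - 2) * steady_dil l y)%:E =
    \int[mu]_(y in `]x, n]) ((l ^+ 2 * l `^ (1 - gamma))%:E * (EFin \o j) (l * y)%R))%E.
  exact: eq_integral.
rewrite ge0_integralZl//; last 3 first.
- apply/measurable_EFinP; apply: measurable_funM.
    by apply: (measurableT_comp (measurable_powR _)); exact: measurable_funTS (mulrl_measurable _).
  have [mGp _] := G_L1.
  apply: (measurable_comp (F := `](0:R), +oo[)) => //.
    move=> _ [y + <-]; rewrite /= !in_itv/= andbT => /andP[xy _].
    by rewrite mulr_gt0// (lt_trans x0).
- move=> y; rewrite /= in_itv/= => /andP[xy _]; have y0 := lt_trans x0 xy.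
  by rewrite lee_fin mulr_ge0 ?powR_ge0// ltW// G_gt0// mulr_gt0.
- by rewrite lee_fin mulr_ge0 ?sqr_ge0 ?powR_ge0.
have fineZ (c : R) (A : \bar R) : 0 < c -> fine (c%:E * A)%E = c * fine A.
  move=> c0; case: A => [a| |]; first by [].
    by rewrite mulry (gtr0_sg c0) mul1e mulr0.
  by rewrite mulrNy (gtr0_sg c0) mul1e mulr0.
rewrite !fineZ ?mulr_gt0 ?exprn_gt0 ?powR_gt0//.
by rewrite expr2 !mulrA; congr (_ * _); ring.
Qed.

(** For positive times this [l] solves [l' = l^(1 - gamma) / gamma], the rate at which the dilated
    profile follows the fragmentation equation. Clipping at 0 keeps it continuous and at least 1 on
    the whole line. *)
Definition scale_factor (t : R) : R := (1 + Num.max t 0) `^ gamma^-1.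

Lemma scale_factor_ge1 t : 1 <= scale_factor t.
Proof.
apply: (@le_trans _ _ (1 `^ gamma^-1)); first by rewrite powR1.
rewrite /scale_factor ge0_ler_powR ?nnegrE ?invr_ge0 ?(ltW gamma0)//.
  by rewrite addr_ge0// le_max lexx orbT.
by rewrite lerDl le_max lexx orbT.
Qed.

Lemma scale_factor_gt0 t : 0 < scale_factor t.
Proof. exact: lt_le_trans (scale_factor_ge1 t). Qed.

Lemma scale_factor_continuous : continuous scale_factor.
Proof.
move=> t; pose f (x : R) := 1 + Num.max x 0.
have cf : {for t, continuous f}.
  apply: cvgD; first exact: cvg_cst.
  by apply: continuous_max; [exact: cvg_id|exact: cvg_cst].
have cg : {for f t, continuous ((@powR R)^~ gamma^-1)}.
  apply/differentiable_continuous/derivable1_diffP.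
  have f0 : 0 < f t by rewrite ltr_pwDl// le_max lexx orbT.
  by have [] := is_derive1_powR gamma^-1 f0.
exact: (continuous_comp cf cg).
Qed.

Lemma steady_dil_continuous (t0 : R) :
  (\int[mu]_y `|steady_dil (scale_factor t) y - steady_dil (scale_factor t0) y|)
    @[t --> t0] --> 0.
Proof.
apply: (@squeeze_cvgr _ _ _ _ (cst 0)
    (fun t => 4 * `|scale_factor t - scale_factor t0|)).
- apply: nearW => t; rewrite Rintegral_ge0//=.
  by apply: steady_dil_dist; exact: scale_factor_ge1.
- exact: cvg_cst.
- rewrite -[X in _ --> X](mulr0 4); apply: cvgM; first exact: cvg_cst.
  have h : scale_factor t - scale_factor t0 @[t --> t0] --> 0.
    rewrite -[X in _ --> X](subrr (scale_factor t0)); apply: cvgB.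
      exact: scale_factor_continuous.
    exact: cvg_cst.
  by apply/norm_cvg0P.
Qed.

Lemma scale_factor_derive (t : R) : 0 < t ->
  is_derive t 1 scale_factor (scale_factor t `^ (1 - gamma) / gamma).
Proof.
move=> t0; have tmax : Num.max t 0 = t by apply/max_idPl/ltW.
have t1 : 0 < 1 + t by rewrite addr_gt0.
have d : is_derive t 1 (fun r => (1 + r) `^ gamma^-1) (scale_factor t `^ (1 - gamma) / gamma).
  have dp := @is_derive1_powR R gamma^-1 (1 + t) t1.
  have dl : is_derive t 1 (fun r : R => 1 + r) 1.
    by apply: is_derive_eq; rewrite add0r mul1r.
  have := @is_derive1_comp R (fun x => x `^ gamma^-1) (fun r => 1 + r) t _ _ dp dl.
  rewrite mulr1 /scale_factor tmax -powRrM.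
  rewrite (_ : gamma^-1 * (1 - gamma) = gamma^-1 - 1); last first.
    by field; rewrite gt_eqF.
  by rewrite mulrC.
apply: near_eq_is_derive d; near=> r; rewrite /scale_factor.
have r0 : 0 < r by near: r; exact: lt_nbhsr.
by rewrite (max_idPl (ltW r0)).
Unshelve. all: by end_near. Qed.

(** The mass below [x] is [cumint (mdens G) (l x)], of derivative
    [l^(2 - gamma) x^2 G(l x) / gamma]. After the correction at [n] there remains the difference
    [G(l x) - G(l n)], an integral over []x, n]] by [weighted_steady_dil]. *)
Lemma steady_dil_evolution (n x t : R) : 0 < n -> 0 <= x -> x <= n -> 0 < t ->
  is_derive t 1 (fun r => cumint (steady_dil (scale_factor r)) x
      - x ^+ 2 / n ^+ 2 * cumint (steady_dil (scale_factor r)) n)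
    (x ^+ 2 * \int[mu]_(y in `]x, n])
       (y `^ (gamma - 2) * steady_dil (scale_factor t) y)).
Proof.
move=> n0; rewrite le_eqVlt => /predU1P[<- _ t0|x0 xn t0].
  rewrite expr0n/=.
  have -> : (fun r => cumint (steady_dil (scale_factor r)) 0 -
      0 / n ^+ 2 * cumint (steady_dil (scale_factor r)) n) = cst 0.
    by apply/funext => r; rewrite cumint0 !mul0r subrr.
  by rewrite mul0r; exact: is_derive_cst.
pose l := scale_factor t; have l0 : 0 < l := scale_factor_gt0 t.
have dK z : 0 < z -> is_derive t 1 (fun r => cumint (mdens G) (scale_factor r * z))
    ((l * z) * G (l * z) * (l `^ (1 - gamma) / gamma * z)).
  move=> z0; have ds := scale_factor_derive t0.
  have dsz : is_derive t 1 (fun r => scale_factor r * z) (l `^ (1 - gamma) / gamma * z).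
    apply: is_derive_eq; rewrite /GRing.scale/=. by rewrite mulr0 add0r mulrC.
  have dc := steady_state_cumint_derive hG (mulr_gt0 l0 z0).
  exact: (@is_derive1_comp R (cumint (mdens G)) (fun r => scale_factor r * z) t _ _ dc dsz).
have Efun z r : cumint (steady_dil (scale_factor r)) z =
    cumint (mdens G) (scale_factor r * z).
  by rewrite cumint_steady_dil// scale_factor_gt0.
rewrite (_ : (fun r => _) = (fun r => cumint (mdens G) (scale_factor r * x)
  - x ^+ 2 / n ^+ 2 * cumint (mdens G) (scale_factor r * n))); last first.
  by apply/funext => r; rewrite !Efun.
rewrite weighted_steady_dil// -/l.
have dx := dK x x0; have dn := dK n n0.
apply: is_derive_eq; rewrite /GRing.scale/=.
by field; rewrite !gt_eqF.
Qed.

Lemma steady_dil_tail (n t : R) : 0 < n ->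
  n `^ gamma * (1 - cumint (steady_dil (scale_factor t)) n) <= 1.
Proof.
move=> n0; rewrite cumint_steady_dil ?scale_factor_gt0//.
apply: le_trans (steady_state_tail gamma2 hG n0).
rewrite ler_wpM2l ?powR_ge0// lerB// (steady_state_cumint_nd hG) ?(ltW n0)//.
by rewrite ler_peMl ?(ltW n0)// scale_factor_ge1.
Qed.

Lemma cumint_steady_dil_le1 (n t : R) : 0 <= n ->
  cumint (steady_dil (scale_factor t)) n <= 1.
Proof.
move=> n0; rewrite cumint_steady_dil ?scale_factor_gt0//.
rewrite (steady_state_cumint_le1 hG)// mulr_ge0// ltW//; exact: scale_factor_gt0.
Qed.

End selfsimilar_steady.

(** * Solutions of the fragmentation equation *)

Section raw_monotonicity.
Context d (T : measurableType d) (R : realType).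
Variable m : {measure set T -> \bar R}.
Local Open Scope ereal_scope.

(* No measurability is assumed: the integral of a nonnegative function is the
   supremum of the integrals of the simple functions below it. *)
Lemma ge0_le_integral_nonmeas (D E : set T) (f g : T -> \bar R) : D `<=` E ->
  (forall x, D x -> 0 <= f x) -> (forall x, E x -> 0 <= g x) ->
  (forall x, D x -> f x <= g x) ->
  \int[m]_(x in D) f x <= \int[m]_(x in E) g x.
Proof.
move=> DE f0 g0 fg; rewrite integral_mkcond [leRHS]integral_mkcond.
have F0 x : 0 <= (f \_ D) x.
  by rewrite patchE; case: ifPn => // /[!inE]; exact: f0.
have FG x : (f \_ D) x <= (g \_ E) x.
  rewrite !patchE; case: ifPn => [/[!inE] Dx|_].
    by rewrite mem_set ?fg//; exact: DE.
  by case: ifPn => // /[!inE]; exact: g0.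
rewrite !ge0_integralTE//; last by move=> x; exact: le_trans (F0 x) (FG x).
apply: ereal_sup_le => _ [h hf <-]; exists h => // x.
exact: le_trans (hf x) (FG x).
Qed.

End raw_monotonicity.

(** * Flux of mass under the fragmentation operator *)

Section fragmentation_flux.
Variable R : realType.
Notation mu := (@lebesgue_measure R).
Variables (gamma : R) (u : R -> R).
Hypothesis gamma2 : 2 <= gamma.
Hypothesis u1 : inL1 (@wmass R) u.
Hypothesis ug : (L1norm (wmom gamma) u < +oo)%E.

Let v := mdens u.
Let w (y : R) := y `^ (gamma - 2) * v y.

Let gamma0 : 0 < gamma. Proof. exact: lt_le_trans gamma2. Qed.

Let mv : measurable_fun setT v.
Proof. by have /integrableP[/measurable_EFinP] := inL1_integrable u1. Qed.

Let mw : measurable_fun setT w.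
Proof. by apply: measurable_funM => //; exact: measurable_powR. Qed.

Lemma mdens_powR y : 0 < y -> y `^ (gamma - 1) * u y = y `^ (gamma - 2) * mdens u y.
Proof.
move=> y0; rewrite mdensE// mulrA; congr (_ * _).
have e : gamma - 1 = gamma - 2 + 1 by ring.
by rewrite e (@powRD _ y (gamma - 2) 1) ?(gt_eqF y0) ?implybT// powRr1 ?(ltW y0).
Qed.

Let w_sqr y : w y * y ^+ 2 = y `^ gamma * v y.
Proof.
have [y0|y0] := ltP 0 y; last by rewrite /w /v mdens0// !mulr0 mul0r.
rewrite /w mulrAC; congr (_ * _).
have e : gamma = gamma - 2 + 2 by ring.
rewrite {2}e (@powRD _ y (gamma - 2) 2) ?(gt_eqF y0) ?implybT//.
by rewrite -(powR_mulrn 2 (ltW y0)).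
Qed.

Let moment_integrable : mu.-integrable setT (EFin \o (fun y => y `^ gamma * v y)).
Proof.
apply/integrableP; split.
  by apply/measurable_EFinP; apply: measurable_funM => //; exact: measurable_powR.
apply: le_lt_trans ug; rewrite /L1norm [leRHS]integral_mkcond.
rewrite le_eqVlt; apply/orP; left; apply/eqP; apply: eq_integral => y _ /=.
have [y0|y0] := ltP 0 y; last first.
  rewrite patchE memNset/= ?in_itv/= ?andbT; last by apply/negP; rewrite -leNgt.
  by rewrite /v mdens0// mulr0 normr0.
rewrite patchE mem_set/= ?in_itv/= ?y0// /v mdensE// /wmom.
rewrite normrM ger0_norm ?powR_ge0// normrM (gtr0_norm y0).
by rewrite addrC powRD ?(gt_eqF y0) ?implybT// powRr1 ?(ltW y0)// mulrA.
Qed.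

Let w_integrable x : 0 < x -> mu.-integrable `]x, +oo[ (EFin \o w).
Proof.
move=> x0; have im : mu.-integrable `]x, +oo[
    (EFin \o (fun y => (x ^+ 2)^-1 * (y `^ gamma * v y))).
  have iS : mu.-integrable `]x, +oo[ (EFin \o (fun y => y `^ gamma * v y)).
    exact: integrableS moment_integrable.
  exact: (integrableZl _ ((x ^+ 2)^-1) iS).
apply: le_integrable im => //; first by apply/measurable_EFinP; exact: measurable_funTS.
move=> y; rewrite /= in_itv/= andbT => xy; have y0 := lt_trans x0 xy.
rewrite lee_fin -w_sqr.
rewrite [X in _ <= `|X|](_ : _ = w y * (y ^+ 2 / x ^+ 2)); last by ring.
rewrite [leRHS]normrM ler_peMr//.
rewrite ger0_norm; last by rewrite divr_ge0 ?sqr_ge0.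
by rewrite ler_pdivlMr ?exprn_gt0// mul1r lerXn2r ?nnegrE ?(ltW x0) ?(ltW y0) ?(ltW xy).
Qed.

Let A y : R := \int[mu]_(z in `]y, +oo[) w z.

Lemma mdens_fragop y : 0 < y ->
  mdens (fragop gamma u) y = 2 * y * A y - y `^ gamma * v y.
Proof.
move=> y0; rewrite mdensE// /fragop /fragB.
have -> : \int[mu]_(z in `]y, +oo[) (fragb gamma z y * u z) = 2 * A y.
  rewrite /A -RintegralZl//; last exact: w_integrable.
  apply: eq_Rintegral => z; rewrite inE/= in_itv/= andbT => yz.
  by rewrite /fragb -mulrA mdens_powR// (lt_trans y0).
by rewrite /v mdensE//; ring.
Qed.

Variable x : R.
Hypothesis x0 : 0 < x.

(** Fubini kernel of the gain of mass in []0, x]]. Integrated in the second variable it gives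
    [2 y A y]; in the first, [w z min(x, z)^2]. For [z <= x] the latter is [z^gamma v z] and cancels
    the loss; for [z > x] it is [x^2 w z], the flux. *)
Let k (p : R * R) : R :=
  2 * p.1 * \1_`]0, x] p.1 * (\1_[set p : R * R | p.1 < p.2] p * w p.2).

Let mk : measurable_fun setT (EFin \o k).
Proof.
apply/measurable_EFinP; apply: measurable_funM.
  apply: measurable_funM; first exact: measurable_funM.
  have m1 : measurable_fun setT (\1_`]0, x] : R -> R).
    by apply: measurable_indic; exact: measurable_itv.
  exact: (measurableT_comp m1 measurable_fst).
apply: measurable_funM; last exact: (measurableT_comp mw measurable_snd).
apply: measurable_indic.
have := @measurable_fun_ltr _ (R * R)%type R setT fst snd measurable_fst measurable_snd.
move=> /(_ measurableT [set true] _); rewrite setTI => H.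
rewrite (_ : [set _ | _] = (fun p : R * R => p.1 < p.2) @^-1` [set true])//.
exact: H.
Qed.

Let kernel_integral (z c : R) : 0 < z ->
  (\int[mu]_y (2 * y * \1_`]0%R, x] y *
     (\1_[set p : R * R | p.1 < p.2] (y, z) * c))%:E = (c * (Num.min x z) ^+ 2)%:E)%E.
Proof.
move=> z0; pose b := Num.min x z; pose g y : \bar R := ((c * 2) * y)%:E.
have b0 : 0 < b by rewrite lt_min x0.
have gb : (\int[mu]_(y in `]0%R, b]) g y = (c * b ^+ 2)%:E)%E.
  rewrite /g; under eq_integral do rewrite EFinM.
  rewrite integralZl//; last exact: integrable_id.
  by rewrite (integral_id (ltW b0)) expr0n subr0 -EFinM; congr EFin; field.
have gE (D : set R) : (forall y, D y <-> `]0, x]%classic y /\ y < z) ->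
    (\int[mu]_y (2 * y * \1_`]0%R, x] y *
     (\1_[set p : R * R | p.1 < p.2] (y, z) * c))%:E = \int[mu]_(y in D) g y)%E.
  move=> HD; rewrite [RHS]integral_mkcond; apply: eq_integral => y _.
  rewrite patchE !indicE; case: ifPn => yD.
    move: yD; rewrite inE => /HD[xy yz]; rewrite !mem_set//= /g.
    by congr EFin; ring.
  have [yx|yx] := boolP (y \in `]0, x]%classic); last by rewrite !(mulr0, mul0r).
  rewrite (_ : (y, z) \in _ = false) ?(mul0r, mulr0)//.
  apply/negP; rewrite inE/= => yz; move/negP : yD; apply; rewrite inE; apply/HD.
  by split=> //; rewrite inE in yx.
rewrite -/b -gb; have [xz|zx] := ltP x z.
  rewrite (gE [set` `]0, x]]); last first.
    move=> y; split => [h|[]//]; split=> //; move: h; rewrite /= in_itv/= => /andP[_ yx].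
    exact: le_lt_trans xz.
  by rewrite /b (min_idPl (ltW xz)).
rewrite (gE [set` `]0, z[]); last first.
  move=> y; rewrite /= !in_itv/=; split => [/andP[-> yz]|[/andP[-> _] ->]]//.
  by rewrite (le_trans (ltW yz)).
rewrite /b (min_idPr zx) integral_itv_bndo_bndc//.
by apply/measurable_EFinP; apply: measurable_funM.
Qed.

Let w0 z : z <= 0 -> w z = 0.
Proof. by move=> z0; rewrite /w /v mdens0// mulr0. Qed.

Let k_int z : (\int[mu]_y (k (y, z))%:E = (w z * (Num.min x z) ^+ 2)%:E)%E.
Proof.
have [z0|z0] := ltP 0 z; first exact: (kernel_integral (w z) z0).
by rewrite w0// mul0r integral0_eq// => y _; rewrite /k/= w0// !mulr0.
Qed.

Let k_abs z : (\int[mu]_y `|(k (y, z))%:E| = (`|w z| * (Num.min x z) ^+ 2)%:E)%E.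
Proof.
have [z0|z0] := ltP 0 z; last first.
  by rewrite w0// normr0 mul0r integral0_eq// => y _; rewrite /k/= w0// !mulr0 normr0.
rewrite -kernel_integral//; apply: eq_integral => y _; rewrite /k/=; congr EFin.
rewrite !normrM !indicE.
have [yx|_] := boolP (y \in `]0, x]%classic); last first.
  by rewrite normr0 !(mulr0, mul0r).
have y0 : 0 < y by move: yx; rewrite inE/= in_itv/= => /andP[].
by case: (_ \in _) => /=; rewrite ?normr0 ?normr1 gtr0_norm// gtr0_norm.
Qed.

Let g z := w z * (Num.min x z) ^+ 2.

Let g_le z : `|w z| * (Num.min x z) ^+ 2 <= `|z `^ gamma * v z|.
Proof.
have [z0|z0] := ltP 0 z; last by rewrite w0// normr0 mul0r.
rewrite -w_sqr [leRHS]normrM ler_wpM2l// ger0_norm ?sqr_ge0//.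
have m0 : 0 < Num.min x z by rewrite lt_min x0.
by rewrite lerXn2r ?nnegrE ?(ltW m0) ?(ltW z0)// ge_min lexx orbT.
Qed.

Let mg : measurable_fun setT g.
Proof.
apply: measurable_funM => //; apply: measurable_funX.
by apply: measurable_minr.
Qed.

Let ik : (mu \x mu)%E.-integrable setT (EFin \o k).
Proof.
apply/(integrable21ltyP mu mu mk).
apply: (@le_lt_trans _ _ (\int[mu]_z `|(z `^ gamma * v z)%:E|)%E); last first.
  by have /integrableP[] := moment_integrable.
apply: ge0_le_integral_nonmeas => // z _; first exact: integral_ge0.
by rewrite [leLHS]k_abs lee_fin g_le.
Qed.

Let ig : mu.-integrable setT (EFin \o g).
Proof.
apply: le_integrable moment_integrable => //; first exact/measurable_EFinP.
move=> z _; rewrite lee_fin /g normrM (ger0_norm (sqr_ge0 _)); exact: g_le.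
Qed.

Let k_int1 y : (\int[mu]_z (k (y, z))%:E =
   ((fun y => 2 * y * A y) \_ `]0, x] y)%:E)%E.
Proof.
rewrite patchE; case: ifPn => yx; last first.
  rewrite integral0_eq// => z _; rewrite /k/= indicE (negbTE yx).
  by rewrite mulr0 mul0r.
have y0 : 0 < y by move: yx; rewrite inE/= in_itv/= => /andP[].
have iw := w_integrable y0.
transitivity (\int[mu]_(z in `]y, +oo[) ((2 * y)%:E * (w z)%:E))%E.
  rewrite [RHS]integral_mkcond; apply: eq_integral => z _.
  rewrite /k/= !indicE yx mulr1 patchE.
  rewrite (_ : ((y, z) \in _) = (z \in `]y, +oo[%classic)); last first.
    by apply/idP/idP; rewrite !inE/= in_itv/= andbT.
  by case: ifPn => _; rewrite ?mul1r ?mul0r ?mulr0 -?EFinM.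
rewrite integralZl//= [RHS]EFinM; congr (_ * _)%E.
by rewrite /A /Rintegral fineK//; apply: integrable_fin_num.
Qed.

Let iA : mu.-integrable `]0, x] (EFin \o (fun y => 2 * y * A y)).
Proof.
have := integrable_fubini_F ik; rewrite /fubini_F.
rewrite (_ : (fun y => _) = (EFin \o (fun y => 2 * y * A y)) \_ `]0, x]).
  by move=> h; apply/(@integrable_mkcond _ _ R mu [set` `](0:R), x]]).
by apply/funext => y; rewrite [LHS]k_int1 restrict_EFin.
Qed.

Let intA : \int[mu]_(y in `]0, x]) (2 * y * A y) = \int[mu]_z g z.
Proof.
rewrite [LHS]Rintegral_mkcond /Rintegral; congr fine.
have := Fubini ik.
rewrite [LHS](_ : _ = \int[mu]_y ((fun y => 2 * y * A y) \_ `]0%R, x] y)%:E)%E; last first.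
  by apply: eq_integral => y _; exact: k_int1.
move=> ->; by apply: eq_integral => z _; exact: k_int.
Qed.

Let intg : \int[mu]_z g z = \int[mu]_(z in `]0, x]) (z `^ gamma * v z) + x ^+ 2 * A x.
Proof.
have -> : \int[mu]_z g z = \int[mu]_(z in `]0, +oo[) g z.
  rewrite [RHS]Rintegral_mkcond; apply: eq_Rintegral => z _; rewrite patchE.
  case: ifPn => //; rewrite notin_setE/= in_itv/= andbT => /negP; rewrite -leNgt => z0.
  by rewrite /g w0// mul0r.
have ig0 : mu.-integrable `]0, +oo[ (EFin \o g) by exact: integrableS ig.
apply/eqP; rewrite addrC -subr_eq.
rewrite -[X in _ - X](@eq_Rintegral _ _ _ mu `]0, x] _ g); last first.
  move=> z; rewrite inE/= in_itv/= => /andP[z0 zx].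
  by rewrite /g (min_idPr zx) w_sqr.
rewrite (Rintegral_itvB ig0) ?bnd_simp//; last exact: ltW.
rewrite /A -RintegralZl//; last exact: w_integrable.
apply/eqP; apply: eq_Rintegral => z; rewrite inE/= in_itv/= andbT => xz.
by rewrite /g (min_idPl (ltW xz)) mulrC.
Qed.

Let imoment : mu.-integrable `]0, x] (EFin \o (fun y => y `^ gamma * v y)).
Proof. exact: integrableS moment_integrable. Qed.

Let fragop_eq y : y \in `]0, x]%classic ->
  mdens (fragop gamma u) y = 2 * y * A y - y `^ gamma * v y.
Proof. by rewrite inE/= in_itv/= => /andP[y0 _]; exact: mdens_fragop. Qed.

Lemma mdens_fragop_integrable :
  mu.-integrable `]0, x] (EFin \o mdens (fragop gamma u)).
Proof.
have iB : mu.-integrable `]0, x] (EFin \o (fun y => 2 * y * A y - y `^ gamma * v y)).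
  exact: (integrableB _ iA imoment).
apply: eq_integrable iB => //.
by move=> y yx; rewrite /= fragop_eq.
Qed.

(* Mass leaves [0, x] only through fragments of particles larger than [x]. *)
Lemma cumint_fragop :
  cumint (mdens (fragop gamma u)) x =
  x ^+ 2 * \int[mu]_(y in `]x, +oo[) (y `^ (gamma - 2) * mdens u y).
Proof.
rewrite /cumint (@eq_Rintegral _ _ _ mu _ _ _ fragop_eq) RintegralB// intA intg.
by rewrite addrC addKr.
Qed.

Lemma integrable_weighted_mdens :
  mu.-integrable `]x, +oo[ (EFin \o (fun y => y `^ (gamma - 2) * mdens u y)).
Proof. exact: w_integrable. Qed.

End fragmentation_flux.

(** * Bochner integrals tested against the corrected mass *)

Section bochner.
Variable R : realType.
Notation mu := (@lebesgue_measure R).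

Lemma integrable_Rsum (D : set R) (N : nat) (g : nat -> R -> R) : measurable D ->
  (forall i, (i < N)%N -> mu.-integrable D (EFin \o g i)) ->
  mu.-integrable D (EFin \o (fun y => \sum_(i < N) g i y)).
Proof.
move=> mD; elim: N => [|N ih] ig.
  by under eq_fun do rewrite big_ord0; exact: integrable0.
under eq_fun do rewrite big_ord_recr/=.
apply: (integrableD _ (ih _) (ig N _)) => // i iN; apply: ig; exact: ltnW.
Qed.

Lemma Rintegral_sum (D : set R) (N : nat) (g : nat -> R -> R) : measurable D ->
  (forall i, (i < N)%N -> mu.-integrable D (EFin \o g i)) ->
  \int[mu]_(y in D) (\sum_(i < N) g i y) = \sum_(i < N) \int[mu]_(y in D) g i y.
Proof.
move=> mD; elim: N => [|N ih] ig.
  rewrite big_ord0; under eq_Rintegral do rewrite big_ord0.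
  by rewrite Rintegral_cst// mul0r.
have ig' i : (i < N)%N -> mu.-integrable D (EFin \o g i).
  by move=> iN; apply: ig; exact: ltnW.
rewrite [RHS]big_ord_recr/= -ih//.
rewrite [LHS](@eq_Rintegral _ _ _ mu D (fun y => \sum_(i < N) g i y + g N y)); last first.
  by move=> y _; rewrite big_ord_recr.
by rewrite RintegralD//; [exact: integrable_Rsum|exact: ig].
Qed.

Lemma mdensB (u v : R -> R) :
  mdens (fun y => u y - v y) = fun y => mdens u y - mdens v y.
Proof.
apply/funext => y; have [y0|y0] := ltP 0 y; last by rewrite !mdens0// subr0.
by rewrite !mdensE// mulrBr.
Qed.

Lemma mdens_sum (N : nat) (c : nat -> R) (v : nat -> R -> R) :
  mdens (fun y => \sum_(i < N) c i * v i y) =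
  fun y => \sum_(i < N) c i * mdens (v i) y.
Proof.
apply/funext => y; have [y0|y0] := ltP 0 y.
  rewrite mdensE// mulr_sumr; apply: eq_bigr => i _.
  by rewrite mdensE// mulrCA.
by rewrite mdens0// big1// => i _; rewrite mdens0// mulr0.
Qed.

Section balance.
Variables (x n : R).
Hypotheses (x0 : 0 <= x) (xn : x <= n) (n0 : 0 < n).

(** The flux through [x] is [x^2] times an integral over []x, +oo[], so this combination of the
    values at [x] and [n] only sees the sizes in []x, n]]. *)
Definition balance (g : R -> R) : R := cumint g x - x ^+ 2 / n ^+ 2 * cumint g n.

Let sub_itv g : mu.-integrable `]0, n] (EFin \o g) -> mu.-integrable `]0, x] (EFin \o g).
Proof. by apply: integrableS => //; exact: subset_itvl. Qed.

Lemma balanceB g h : mu.-integrable `]0, n] (EFin \o g) ->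
  mu.-integrable `]0, n] (EFin \o h) ->
  balance (fun y => g y - h y) = balance g - balance h.
Proof.
move=> ig ih; rewrite /balance /cumint !RintegralB//; try exact: sub_itv.
by ring.
Qed.

Lemma balance_sum (N : nat) (c : nat -> R) (g : nat -> R -> R) :
  (forall i, (i < N)%N -> mu.-integrable `]0, n] (EFin \o g i)) ->
  balance (fun y => \sum_(i < N) c i * g i y) = \sum_(i < N) c i * balance (g i).
Proof.
move=> ig; have igc i : (i < N)%N ->
    mu.-integrable `]0, n] (EFin \o (fun y => c i * g i y)).
  by move=> iN; exact: (integrableZl _ (c i) (ig i iN)).
rewrite /balance /cumint (@Rintegral_sum _ _ (fun i y => c i * g i y))//; last first.
  by move=> i iN; apply: sub_itv; exact: igc.
rewrite (@Rintegral_sum _ _ (fun i y => c i * g i y))// mulr_sumr -sumrB.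
apply: eq_bigr => i _; have iN := ltn_ord i.
rewrite !RintegralZl//; first by ring.
- exact: ig.
- by apply: sub_itv; exact: ig.
Qed.

Lemma balance_le g : mu.-integrable `]0, n] (EFin \o g) ->
  (`|balance g|%:E <= 2%:E * \int[mu]_y `|g y|%:E)%E.
Proof.
move=> ig; have hz z : z <= n -> (`|cumint g z|%:E <= \int[mu]_y `|g y|%:E)%E.
  move=> zn; have igz : mu.-integrable `]0, z] (EFin \o g).
    by apply: integrableS ig => //; exact: subset_itvl.
  rewrite EFin_normr_Rintegral//.
  apply: le_trans (le_abse_integral _ _ _) _ => //; first by case/integrableP : igz.
  exact: ge0_le_integral_nonmeas.
have r1 : 0 <= x ^+ 2 / n ^+ 2 <= 1.
  rewrite divr_ge0 ?sqr_ge0//= ler_pdivrMr ?exprn_gt0// mul1r.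
  by rewrite lerXn2r ?nnegrE ?(ltW n0).
apply: (@le_trans _ _ (`|cumint g x|%:E + `|cumint g n|%:E)%E).
  rewrite -EFinD lee_fin (le_trans (ler_normB _ _))// lerD2l normrM.
  by move/andP: r1 => [r0 r1]; rewrite ger0_norm// ler_piMl.
have -> : (2%:E * \int[mu]_y `|g y|%:E = \int[mu]_y `|g y|%:E + \int[mu]_y `|g y|%:E)%E.
  by rewrite mule_natl mule2n.
by apply: leeD; exact: hz.
Qed.

(** A bounded linear functional commutes with the Bochner integral: this is exact on simple
    functions, and [balance] is bounded by twice the L^1 norm, which controls both errors by [a k]
    and [b k]. *)
Lemma bochner_balance (T : R) (U : R -> R -> R) (h phi : R -> R) :
  0 <= T -> bochner_int (@wmass R) T U h -> continuous phi ->
  {ae mu, forall s, 0 <= s <= T ->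
    mu.-integrable `]0, n] (EFin \o mdens (U s)) /\ balance (mdens (U s)) = phi s} ->
  balance (mdens h) = \int[mu]_(s in `[0, T]) phi s.
Proof.
move=> T0 [hL1 [N [A [v [HA _ Ha Hb]]]]] cphi [Nul [mNul muNul HNul]].
have iv k i : (i < N k)%N -> mu.-integrable `]0, n] (EFin \o mdens (v k i)).
  by move=> iN; have [_ _ /inL1_integrable] := HA k i iN; exact: integrableS.
have ih : mu.-integrable `]0, n] (EFin \o mdens h).
  exact: integrableS (inL1_integrable hL1).
pose S k s y : R := \sum_(i < N k) \1_(A k i) s * v k i y.
pose l k s := \sum_(i < N k) \1_(A k i) s * balance (mdens (v k i)).
pose H k y : R := \sum_(i < N k) fine (mu (A k i)) * v k i y.
pose I k := \sum_(i < N k) fine (mu (A k i)) * balance (mdens (v k i)).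
have iS k s : mu.-integrable `]0, n] (EFin \o mdens (S k s)).
  rewrite /S (mdens_sum (N k) (fun i => \1_(A k i) s)).
  apply: (@integrable_Rsum _ _ (fun i y => \1_(A k i) s * mdens (v k i) y)) => // i iN.
  exact: (integrableZl _ _ (iv k i iN)).
have iH k : mu.-integrable `]0, n] (EFin \o mdens (H k)).
  rewrite /H (mdens_sum (N k) (fun i => fine (mu (A k i)))).
  apply: (@integrable_Rsum _ _ (fun i y => fine (mu (A k i)) * mdens (v k i) y)) => // i iN.
  exact: (integrableZl _ _ (iv k i iN)).
have SE k s : balance (mdens (S k s)) = l k s.
  rewrite /S (mdens_sum (N k) (fun i => \1_(A k i) s)).
  exact: (@balance_sum (N k) (fun i => \1_(A k i) s) (fun i => mdens (v k i)) (iv k)).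
have HE k : balance (mdens (H k)) = I k.
  rewrite /H (mdens_sum (N k) (fun i => fine (mu (A k i)))).
  exact: (@balance_sum (N k) (fun i => fine (mu (A k i))) (fun i => mdens (v k i)) (iv k)).
have muT : (mu [set` `[0%R, T]] < +oo)%E.
  by rewrite lebesgue_measure_itv/=; case: ifPn => _; rewrite ltry.
have iA k i : (i < N k)%N -> mu.-integrable `[0, T] (EFin \o (\1_(A k i) : R -> R)).
  move=> iN; have [mA _ _] := HA k i iN.
  apply: measurable_bounded_integrable => //.
  exists 1; split; first exact: num_real.
  move=> M M1 s _; rewrite /= indicE; case: (s \in _) => /=.
    by rewrite normr1 ltW.
  by rewrite normr0 (le_trans ler01)// ltW.
have iAc k i : (i < N k)%N -> mu.-integrable `[0, T]
    (EFin \o (fun s => \1_(A k i) s * balance (mdens (v k i)))).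
  move=> iN; exact: (integrableZr _ (balance (mdens (v k i))) (iA k i iN)).
have il k : mu.-integrable `[0, T] (EFin \o l k).
  apply: (@integrable_Rsum _ _ (fun i s => \1_(A k i) s * balance (mdens (v k i)))) => //.
  exact: (iAc k).
have IE k : I k = \int[mu]_(s in `[0, T]) l k s.
  rewrite /l (@Rintegral_sum _ _ (fun i s => \1_(A k i) s * balance (mdens (v k i))))//; last first.
    exact: (iAc k).
  apply: eq_bigr => i _; have iN := ltn_ord i; have [mA AT _] := HA k i iN.
  rewrite RintegralZr//; last exact: iA.
  by rewrite /Rintegral integral_indic// setIidl.
have iphi : mu.-integrable `[0, T] (EFin \o phi).
  apply: continuous_compact_integrable; first exact: segment_compact.
  exact: continuous_subspaceT.
set a := (X in X @ \oo --> _) in Ha; set b := (X in X @ \oo --> _) in Hb.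
have hI k : (`|balance (mdens h) - I k|%:E <= 2%:E * b k)%E.
  rewrite -HE -balanceB// /b L1normE mdensB; apply: balance_le.
  exact: (integrableB _ ih (iH k)).
have pI k : (`|\int[mu]_(s in `[0, T]) phi s - I k|%:E <= 2%:E * a k)%E.
  have ipl : mu.-integrable `[0, T] (EFin \o (fun s => phi s - l k s)).
    exact: (integrableB _ iphi (il k)).
  have ipn : mu.-integrable `[0, T] (EFin \o (fun s => `|phi s - l k s|)).
    exact: integrable_norm ipl.
  have iph : mu.-integrable `[0, T] (EFin \o (fun s => 2^-1 * `|phi s - l k s|)).
    exact: (integrableZl _ (2^-1) ipn).
  rewrite IE -RintegralB//.
  (* The constant 2 is kept on the side of a measurable integrand: that of [a k] is not known to be
     measurable, and is reached by monotonicity alone. *)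
  apply: (@le_trans _ _ (2 * \int[mu]_(s in `[0, T]) (2^-1 * `|phi s - l k s|))%:E).
    rewrite lee_fin RintegralZl// mulrA divff// mul1r.
    exact: le_normr_Rintegral.
  rewrite EFinM lee_pmul2l// /Rintegral fineK; last exact: integrable_fin_num.
  rewrite (ge0_negligible_integral _ _ _ _ muNul)//; last by case/integrableP : iph.
  apply: ge0_le_integral_nonmeas.
  - by move=> s [].
  - by move=> s _; rewrite lee_fin mulr_ge0.
  - by move=> s _; rewrite L1normE; exact: integral_ge0.
  - move=> s [/= sT sNul].
    have [iU UE] : mu.-integrable `]0, n] (EFin \o mdens (U s)) /\
        balance (mdens (U s)) = phi s.
      by apply: contrapT => nU; apply: sNul; apply: HNul => /(_ _)/nU; apply;
        move: sT; rewrite in_itv.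
    rewrite -UE -SE -balanceB// EFinM L1normE (mdensB _ (S k s)).
    rewrite lee_pdivrMl//.
    by apply: balance_le; exact: (integrableB _ iU (iS k s)).
have cle k : (`|balance (mdens h) - \int[mu]_(s in `[0, T]) phi s|%:E <=
    2%:E * b k + 2%:E * a k)%E.
  apply: le_trans (leeD (hI k) (pI k)).
  by rewrite -EFinD lee_fin [X in _ <= _ + X]distrC ler_distD.
have ab0 : (2%:E * b k + 2%:E * a k)%E @[k --> \oo] --> 0%E.
  rewrite -[X in _ --> X]adde0; apply: cvgeD => //.
    by rewrite -[X in _ --> X](mule0 2%:E); apply: cvgeZl.
  by rewrite -[X in _ --> X](mule0 2%:E); apply: cvgeZl.
apply/eqP; rewrite -subr_eq0 -normr_le0.
suff : (`|balance (mdens h) - \int[mu]_(s in `[0, T]) phi s|%:E <= 0)%E by rewrite lee_fin.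
rewrite -(cvg_lim (@ereal_hausdorff R) ab0).
apply: lime_ge; first by apply/cvg_ex; exists 0%E.
exact: nearW.
Qed.

End balance.
End bochner.

(** * Evolution and tail of a solution *)

Section fragmentation_solution.
Variable R : realType.
Notation mu := (@lebesgue_measure R).
Variables (gamma : R) (gin : R -> R) (f : R -> R -> R).
Hypothesis gamma2 : 2 <= gamma.
Hypothesis gin1 : inL1 (@wmass R) gin.
Hypothesis hf : frag_solution gamma gin f.

Let f_meas : measurable_fun (`[(0:R), +oo[ `*` `](0:R), +oo[) (fun p : R * R => f p.1 p.2).
Proof. by case: hf. Qed.
Let f_L1 t : 0 <= t -> inL1 (@wmass R) (f t).
Proof. by have [_ [+ _] _ _ _] := hf; exact. Qed.
Let f_int t : 0 <= t -> mu.-integrable setT (EFin \o mdens (f t)).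
Proof. by move=> t0; apply: inL1_integrable; exact: f_L1. Qed.

(** By Tonelli, joint measurability makes the moment a measurable function of time; having a finite
    integral over [[0, T]], it is finite almost everywhere. *)
Lemma ae_moment (T : R) : 0 < T ->
  {ae mu, forall s, 0 <= s <= T -> (L1norm (wmom gamma) (f s) < +oo)%E}.
Proof.
move=> T0; have [_ _ /(_ T T0) mom _ _] := hf.
pose D : set (R * R) := `[(0:R), +oo[ `*` `](0:R), +oo[.
pose K0 : R * R -> \bar R := EFin \o (fun p => wmom gamma p.2 * `|f p.1 p.2|).
have mD : measurable D by apply: measurableX; exact: measurable_itv.
have mK : measurable_fun setT (K0 \_ D).
  apply/(measurable_restrictT _ _).1 => //; apply/measurable_EFinP; apply: measurable_funM.
    have mw : measurable_fun setT (wmom gamma) by exact: measurable_powR.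
    by apply: measurable_funTS; exact: (measurableT_comp mw measurable_snd).
  exact: measurableT_comp.
have K_ge0 p : (0 <= (K0 \_ D) p)%E.
  by rewrite patchE; case: ifPn => // _; rewrite lee_fin mulr_ge0// powR_ge0.
pose F s := (\int[mu]_y (K0 \_ D) (s, y))%E.
have mF : measurable_fun setT F.
  exact: (@measurable_fun_fubini_tonelli_F _ _ _ _ R mu (K0 \_ D)).
have FE s : 0 <= s -> F s = L1norm (wmom gamma) (f s).
  move=> s0; rewrite /L1norm [RHS]integral_mkcond; apply: eq_integral => y _.
  rewrite !patchE; congr (if _ then _ else _).
  apply/idP/idP; rewrite !inE; first by case.
  by move=> yD; split => //; rewrite /= in_itv/= s0.
have iF : mu.-integrable `[0, T] F.
  apply/integrableP; split; first exact: measurable_funTS.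
  apply: le_lt_trans mom; rewrite le_eqVlt; apply/orP; left; apply/eqP.
  apply: eq_integral => s; rewrite inE/= in_itv/= => /andP[s0 _].
  by rewrite -FE// gee0_abs//; exact: integral_ge0.
have : {ae mu, forall s, [set` `[0%R, T]] s -> F s \is a fin_num}.
  by apply: integrable_ae iF.
apply: filterS; first exact: (ae_filter_ringOfSetsType mu).
move=> s Fs /andP[s0 sT]; rewrite -FE// -ge0_fin_numE; last exact: integral_ge0.
by apply: Fs; rewrite /= in_itv/= s0.
Qed.

Let pf t : R -> R := mdens (f (Num.max t 0)).

Let max0_ge0 (t : R) : 0 <= Num.max t 0. Proof. by rewrite le_max lexx orbT. Qed.

Lemma frag_integrable t : mu.-integrable setT (EFin \o mdens (f (Num.max t 0))).
Proof. exact: f_int. Qed.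

Lemma frag_continuous t0 :
  (\int[mu]_y `|mdens (f (Num.max t 0)) y - mdens (f (Num.max t0 0)) y|)
    @[t --> t0] --> 0.
Proof.
have [_ [_ /(_ _ (max0_ge0 t0)) cf] _ _ _] := hf.
have cmax : Num.max t 0 @[t --> t0] --> within `[(0:R), +oo[ (nbhs (Num.max t0 0)).
  have cm : Num.max t 0 @[t --> t0] --> Num.max t0 0.
    by apply: continuous_max; [exact: cvg_id|exact: cvg_cst].
  move=> P HP.
  have H : \forall t \near t0, [set` `[(0:R), +oo[] (Num.max t 0) -> P (Num.max t 0).
    exact: cm HP.
  by apply: filterS H => t; apply; rewrite /mkset in_itv/= andbT max0_ge0.
have := cvg_comp _ _ cmax cf.
move/fine_cvgP => [_]; apply: cvg_trans; apply: near_eq_cvg; apply: nearW => t.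
by rewrite /= L1normE mdensB.
Qed.

Let pf_int := frag_integrable.
Let pf_cont := frag_continuous.

Let flux x n s := x ^+ 2 * \int[mu]_(y in `]x, n]) (y `^ (gamma - 2) * pf s y).

Let q0 : 0 <= gamma - 2. Proof. by rewrite subr_ge0. Qed.

(** On []x, n]] the weight is at most [n^(gamma - 2)], so continuity in L^1 is enough. *)
Let flux_continuous x n : 0 <= x -> x <= n -> continuous (flux x n).
Proof.
move=> x0 xn s0; apply: cvgM; first exact: cvg_cst.
apply/subr_cvg0; apply: (@norm_cvg0 _ R^o).
apply: (@squeeze_cvgr _ _ _ _ (cst 0)
    (fun s => n `^ (gamma - 2) * \int[mu]_y `|pf s y - pf s0 y|)).
- apply: nearW => s; rewrite normr_ge0/=.
  have ip t := integrable_powR_mul n q0 x0 (pf_int t).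
  rewrite -RintegralB//; try exact: ip.
  have iB : mu.-integrable `]x, n] (EFin \o (fun y => y `^ (gamma - 2) * pf s y
      - y `^ (gamma - 2) * pf s0 y)).
    exact: (integrableB _ (ip s) (ip s0)).
  apply: le_trans (le_normr_Rintegral _ iB) _ => //.
  have iD : mu.-integrable setT (EFin \o (fun y => pf s y - pf s0 y)).
    exact: (integrableB _ (pf_int s) (pf_int s0)).
  have iDn : mu.-integrable setT (EFin \o (fun y => n `^ (gamma - 2) * `|pf s y - pf s0 y|)).
    exact: (integrableZl _ _ (integrable_norm iD)).
  apply: (@le_trans _ _ (\int[mu]_(y in `]x, n]) (n `^ (gamma - 2) * `|pf s y - pf s0 y|))).
    apply: le_Rintegral => //.
    + exact: integrable_norm iB.
    + exact: integrableS iDn.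
    move=> y; rewrite /= in_itv/= => /andP[xy yn]; have y0 := le_lt_trans x0 xy.
    rewrite -mulrBr normrM ler_wpM2r// ger0_norm ?powR_ge0//.
    by rewrite ge0_ler_powR ?nnegrE ?(ltW y0)// (le_trans (ltW y0)).
  rewrite -RintegralZl//; last exact: integrable_norm iD.
  rewrite -lee_fin /Rintegral !fineK; try exact: integrable_fin_num.
    apply: ge0_le_integral_nonmeas => // y _; rewrite lee_fin mulr_ge0 ?powR_ge0//.
  by apply: integrable_fin_num => //; exact: integrableS iDn.
- exact: cvg_cst.
- rewrite -[X in _ --> X](mulr0 (n `^ (gamma - 2))); apply: cvgM; first exact: cvg_cst.
  exact: pf_cont.
Qed.

Lemma frag_balance (x n t : R) : 0 <= x -> x <= n -> 0 < n -> 0 <= t ->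
  balance x n (mdens (fun y => f t y - gin y)) = \int[mu]_(s in `[0, t]) flux x n s.
Proof.
move=> x0 xn n0 t0; have [_ _ _ _ /(_ t t0) bf] := hf.
apply: (bochner_balance x0 xn n0 t0 bf (flux_continuous x0 xn)).
have t1 : 0 < t + 1 by rewrite ltr_wpDl.
have := ae_moment t1; apply: filterS; first exact: (ae_filter_ringOfSetsType mu).
move=> s ms /andP[s0 st].
have {}ms : (L1norm (wmom gamma) (f s) < +oo)%E.
  by apply: ms; rewrite s0/= (le_trans st)// lerDl.
have fs := f_L1 s0.
split; first exact: mdens_fragop_integrable.
rewrite /balance /flux /pf (max_idPl s0).
have cn := cumint_fragop fs ms n0.
move: x0; rewrite le_eqVlt => /predU1P[x0|x0].
  by rewrite -x0 cumint0 expr0n/= !mul0r subrr.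
rewrite cn (cumint_fragop fs ms x0).
rewrite mulrA divfK ?sqrf_eq0 ?gt_eqF// -mulrBr; congr (_ * _).
have ix := integrable_weighted_mdens fs ms x0.
rewrite -(Rintegral_itvB ix (x := n)) ?bnd_simp//.
by rewrite opprB addrC subrK.
Qed.

Lemma frag_evolution (n x t : R) : 0 < n -> 0 <= x -> x <= n -> 0 < t ->
  is_derive t 1 (fun r => cumint (mdens (f (Num.max r 0))) x
      - x ^+ 2 / n ^+ 2 * cumint (mdens (f (Num.max r 0))) n)
    (x ^+ 2 * \int[mu]_(y in `]x, n]) (y `^ (gamma - 2) * mdens (f (Num.max t 0)) y)).
Proof.
move=> n0 x0 xn t0; rewrite -/(flux x n t).
have cfl := flux_continuous x0 xn.
have ifl (T : R) : mu.-integrable `[0, T] (EFin \o flux x n).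
  apply: continuous_compact_integrable; first exact: segment_compact.
  exact: continuous_subspaceT.
pose B (r : R) : R := \int[mu]_(s in `[0, r]) flux x n s.
have tt1 : t < t + 1 by rewrite ltrDl.
have [dB1 dB2] := continuous_FTC1_closed tt1 (ifl _) t0 (cfl t).
have dB : is_derive t 1 B (flux x n t) by rewrite -dB2 derive1E; exact/derivableP.
have dcB : is_derive t 1 (fun r => balance x n (mdens gin) + B r) (flux x n t).
  by apply: is_derive_eq; rewrite add0r mul1r.
apply: near_eq_is_derive dcB; near=> r.
have r0 : 0 < r by near: r; exact: lt_nbhsr.
rewrite /B -(frag_balance x0 xn n0 (ltW r0)) mdensB balanceB//.
- by rewrite addrC subrK /balance (max_idPl (ltW r0)).
- by apply: integrableS (f_int (ltW r0)).
- by apply: integrableS (inL1_integrable gin1).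
Unshelve. all: by end_near. Qed.

(** The simple functions of the Bochner integral over [[0, 0]] are supported in a null set, so their
    integrals vanish and [f 0 - gin] has norm 0. *)
Lemma frag_initial : {ae mu, forall y, mdens (f 0) y = mdens gin y}.
Proof.
have [_ _ _ _ /(_ 0 (lexx 0))] := hf.
move=> [hL1 [N [A [v [HA _ _ Hb]]]]].
have L0 : L1norm (@wmass R) (fun y => f 0 y - gin y) = 0%E.
  move: Hb; rewrite (_ : (fun k => _) = cst (L1norm (@wmass R) (fun y => f 0 y - gin y))).
    by move/cvg_lim => <-//; rewrite lim_cst.
  apply/funext => k; congr L1norm; apply/funext => y.
  rewrite big1 ?subr0// => i _; have [mA A0 _] := HA k i (ltn_ord i).
  rewrite (_ : mu (A k i) = 0%E) ?mul0r//.
  have m00 : mu [set` `[(0:R), 0]] = 0%E by rewrite set_itv1 lebesgue_measure_set1.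
  apply/eqP; rewrite eq_le measure_ge0 andbT -[leRHS]m00.
  by apply: le_measure => //; rewrite inE//; exact: measurable_itv.
have ih := inL1_integrable hL1.
have : {ae mu, forall y, setT y ->
    (EFin \o mdens (fun y => f 0 y - gin y)) y = cst 0%E y}.
  apply/ae_eq_integral_abs => //; first by case/integrableP : ih.
  by rewrite -L0 L1normE.
apply: filterS; first exact: (ae_filter_ringOfSetsType mu).
move=> y /(_ I)/= []; rewrite mdensB => /eqP.
by rewrite subr_eq0 => /eqP.
Qed.

Lemma frag_mass t : 0 <= t -> mass (f t) = mass gin.
Proof.
rewrite le_eqVlt => /predU1P[<-|t0]; last by have [_ _ _ + _] := hf; exact.
rewrite !massE /Rintegral; congr fine; apply: ae_eq_integral => //.
- by case/integrableP : (f_int (lexx 0)).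
- by case/integrableP : (inL1_integrable gin1).
have := frag_initial; apply: filterS; first exact: (ae_filter_ringOfSetsType mu).
by move=> y /= -> _.
Qed.

(** By conservation of mass the difference is the mass beyond [n], where
    [n^gamma y <= y^(1 + gamma)]. The constant is the time integral of the moment. *)
Lemma frag_tail T : 0 < T -> exists C : R, forall n, 0 < n ->
  n `^ gamma * \int[mu]_(r in `[0, T])
    `|mass gin - cumint (mdens (f (Num.max r 0))) n| <= C.
Proof.
move=> T0; have [_ _ /(_ T T0) mom _ _] := hf.
set E := (\int[mu]_(t in _) _)%E in mom.
have E0 : (0 <= E)%E.
  apply: integral_ge0 => t _; apply: integral_ge0 => y _.
  by rewrite lee_fin mulr_ge0// powR_ge0.
exists (fine E) => n n0.
pose c r := mass gin - cumint (pf r) n.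
have cc : continuous (fun r => `|c r|).
  move=> r; apply: cvg_norm; apply: cvgB; first exact: cvg_cst.
  exact: (curve_cumint_continuous pf_int pf_cont (ltW n0)).
have ic : mu.-integrable `[0, T] (EFin \o (fun r => `|c r|)).
  apply: continuous_compact_integrable; first exact: segment_compact.
  exact: continuous_subspaceT.
have inc : mu.-integrable `[0, T] (EFin \o (fun r => n `^ gamma * `|c r|)).
  exact: (integrableZl _ _ ic).
have fE : (fine E)%:E = E by rewrite fineK// ge0_fin_numE.
rewrite -RintegralZl// -lee_fin fE /Rintegral fineK; last exact: integrable_fin_num.
apply: ge0_le_integral_nonmeas => //.
- by move=> r _; rewrite lee_fin mulr_ge0 ?powR_ge0.
- by move=> r _; apply: integral_ge0 => y _; rewrite lee_fin mulr_ge0// powR_ge0.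
move=> r; rewrite /= in_itv/= => /andP[r0 _].
have ifr : mu.-integrable `]n, +oo[ (EFin \o mdens (f r)).
  exact: integrableS (f_int r0).
rewrite /c /pf (max_idPl r0) -(frag_mass r0) cumint_mass ?(ltW n0)//; last exact: f_L1.
have inr : mu.-integrable `]n, +oo[ (EFin \o (fun y => n `^ gamma * `|mdens (f r) y|)).
  exact: (integrableZl _ _ (integrable_norm ifr)).
apply: (@le_trans _ _ (\int[mu]_(y in `]n, +oo[) (n `^ gamma * `|mdens (f r) y|))%:E).
  rewrite lee_fin RintegralZl//; last exact: integrable_norm.
  by rewrite ler_wpM2l ?powR_ge0// le_normr_Rintegral.
rewrite /Rintegral fineK; last exact: integrable_fin_num.
apply: ge0_le_integral_nonmeas.
- by move=> y; rewrite /= !in_itv/= !andbT; exact: lt_trans.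
- by move=> y _; rewrite lee_fin mulr_ge0 ?powR_ge0.
- by move=> y _; rewrite lee_fin mulr_ge0 ?powR_ge0.
move=> y; rewrite /= in_itv/= andbT => ny; have y0 := lt_trans n0 ny.
rewrite lee_fin mdensE// normrM (gtr0_norm y0) mulrA ler_wpM2r// /wmom.
rewrite addrC powRD ?(gt_eqF y0) ?implybT// powRr1 ?(ltW y0)// ler_wpM2r ?(ltW y0)//.
by rewrite ge0_ler_powR ?nnegrE ?(ltW y0) ?(ltW n0) ?(ltW ny)// (le_trans _ gamma2).
Qed.

End fragmentation_solution.

(** * Decay *)

Section deviation.
Variable R : realType.
Notation mu := (@lebesgue_measure R).
Variables (gamma : R) (gin : R -> R) (f : R -> R -> R) (G : R -> R).
Hypothesis gamma2 : 2 <= gamma.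
Hypothesis gin1 : inL1 (@wmass R) gin.
Hypothesis hf : frag_solution gamma gin f.
Hypothesis hG : steady_state gamma G.

Let a (t : R) : R -> R := mdens (f (Num.max t 0)).
Let d (t : R) : R -> R := steady_dil G (scale_factor gamma t).

(* Times are clipped at 0 to make derivatives and limits two-sided. *)
Definition deviation (t y : R) : R :=
  mdens (f (Num.max t 0)) y - mass gin * steady_dil G (scale_factor gamma t) y.

Let ia t : mu.-integrable setT (EFin \o a t).
Proof. exact: frag_integrable hf t. Qed.

Let idl t : mu.-integrable setT (EFin \o d t).
Proof. exact: (integrable_steady_dil hG (scale_factor_gt0 gamma2 t)). Qed.

Let iZd (c t : R) : mu.-integrable setT (EFin \o (fun y => c * d t y)).
Proof. exact: (integrableZl _ c (idl t)). Qed.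

Lemma deviation_integrable t : mu.-integrable setT (EFin \o deviation t).
Proof. exact: (integrableB _ (ia t) (iZd (mass gin) t)). Qed.

Let cumint_deviation t x :
  cumint (deviation t) x = cumint (a t) x - mass gin * cumint (d t) x.
Proof.
rewrite /cumint RintegralB//; last 2 first.
- exact: integrableS (ia t).
- exact: integrableS (iZd _ t).
by rewrite RintegralZl//; exact: integrableS (idl t).
Qed.

Lemma deviation_continuous t0 :
  (\int[mu]_y `|deviation t y - deviation t0 y|) @[t --> t0] --> 0.
Proof.
apply: (@squeeze_cvgr _ _ _ _ (cst 0) (fun t => \int[mu]_y `|a t y - a t0 y|
   + `|mass gin| * \int[mu]_y `|d t y - d t0 y|)).
- apply: nearW => t; apply/andP; split.
    by apply: Rintegral_ge0 => y _; exact: normr_ge0.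
  have iA : mu.-integrable setT (EFin \o (fun y => `|a t y - a t0 y|)).
    exact: (integrable_norm (integrableB _ (ia t) (ia t0))).
  have iD : mu.-integrable setT (EFin \o (fun y => `|d t y - d t0 y|)).
    exact: (integrable_norm (integrableB _ (idl t) (idl t0))).
  have iZD : mu.-integrable setT (EFin \o (fun y => `|mass gin| * `|d t y - d t0 y|)).
    exact: (integrableZl _ _ iD).
  have iP : mu.-integrable setT (EFin \o (fun y => `|deviation t y - deviation t0 y|)).
    exact: (integrable_norm (integrableB _ (deviation_integrable t) (deviation_integrable t0))).
  rewrite -RintegralZl// -RintegralD//; apply: le_Rintegral => //.
    exact: (integrableD _ iA iZD).
  move=> y _; rewrite -normrM /deviation -/(a t) -/(a t0) -/(d t) -/(d t0).
  rewrite (_ : _ - _ = (a t y - a t0 y) - mass gin * (d t y - d t0 y)); last by ring.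
  exact: ler_normB.
- exact: cvg_cst.
- rewrite -[X in _ --> X](addr0 (0 : R)); apply: cvgD; first exact: frag_continuous hf t0.
  rewrite -[X in _ --> X](mulr0 `|mass gin|); apply: cvgM; first exact: cvg_cst.
  exact: steady_dil_continuous gamma2 hG t0.
Qed.

Lemma deviation_evolution (n x t : R) : 0 < n -> 0 <= x -> x <= n -> 0 < t ->
  is_derive t 1 (fun r => cumint (deviation r) x - x ^+ 2 / n ^+ 2 * cumint (deviation r) n)
    (x ^+ 2 * \int[mu]_(y in `]x, n]) (y `^ (gamma - 2) * deviation t y)).
Proof.
move=> n0 x0 xn t0; have q0 : 0 <= gamma - 2 by rewrite subr_ge0.
have da := frag_evolution gamma2 gin1 hf n0 x0 xn t0.
have dd := steady_dil_evolution gamma2 hG n0 x0 xn t0.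
rewrite (_ : (fun r => _) = (fun r => (cumint (a r) x - x ^+ 2 / n ^+ 2 * cumint (a r) n)
   - mass gin * (cumint (d r) x - x ^+ 2 / n ^+ 2 * cumint (d r) n))); last first.
  by apply/funext => r; rewrite !cumint_deviation; ring.
have iwa := integrable_powR_mul n q0 x0 (ia t).
have iwd := integrable_powR_mul n q0 x0 (idl t).
have iwZd : mu.-integrable `]x, n] (EFin \o (fun y => mass gin * (y `^ (gamma - 2) * d t y))).
  exact: (integrableZl _ _ iwd).
have -> : \int[mu]_(y in `]x, n]) (y `^ (gamma - 2) * deviation t y) =
    \int[mu]_(y in `]x, n]) (y `^ (gamma - 2) * a t y)
    - mass gin * \int[mu]_(y in `]x, n]) (y `^ (gamma - 2) * d t y).
  rewrite -RintegralZl// -RintegralB//; apply: eq_Rintegral => y _.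
  by rewrite /deviation -/(a t) -/(d t); ring.
rewrite mulrBr mulrCA; apply: is_deriveB.
Qed.

(** As the deviation has zero mass, its mass below [n] is a difference of two tails beyond [n],
    bounded by [frag_tail] and [steady_dil_tail]. *)
Lemma deviation_tail (T : R) : 0 < T -> exists C : R, forall n, 0 < n ->
  n `^ (gamma - 2 + 2) * \int[mu]_(r in `[0, T]) `|cumint (deviation r) n| <= C.
Proof.
move=> T0; have [C HC] := frag_tail gamma2 gin1 hf T0.
exists (C + `|mass gin| * T) => n n0; rewrite subrK.
pose c r := mass gin - cumint (a r) n.
have iC (h : R -> R) : continuous h -> mu.-integrable `[0, T] (EFin \o (fun r => `|h r|)).
  move=> ch; apply: continuous_compact_integrable; first exact: segment_compact.
  by apply: continuous_subspaceT => r; apply: cvg_norm; exact: ch.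
have ic : mu.-integrable `[0, T] (EFin \o (fun r => `|c r|)).
  apply: iC => r; apply: cvgB; first exact: cvg_cst.
  exact: (curve_cumint_continuous ia (frag_continuous hf) (ltW n0)).
have ip : mu.-integrable `[0, T] (EFin \o (fun r => `|cumint (deviation r) n|)).
  apply: iC; exact: (curve_cumint_continuous deviation_integrable deviation_continuous (ltW n0)).
have inc : mu.-integrable `[0, T] (EFin \o (fun r => n `^ gamma * `|c r|)).
  exact: (integrableZl _ _ ic).
have inp : mu.-integrable `[0, T] (EFin \o (fun r => n `^ gamma * `|cumint (deviation r) n|)).
  exact: (integrableZl _ _ ip).
have icst : mu.-integrable `[0, T] (EFin \o (fun=> `|mass gin|)).
  by apply: (iC (cst (mass gin))) => r; exact: cvg_cst.
apply: le_trans (lerD (HC n n0) (lexx _)).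
rewrite -RintegralZl//.
have -> : `|mass gin| * T = \int[mu]_(r in `[0, T]) `|mass gin|.
  have mT : mu [set` `[0, T]] = T%:E.
    by rewrite lebesgue_measure_itv/= lte_fin T0 oppr0 adde0.
  by rewrite Rintegral_cst//; congr (_ * _); exact: esym (congr1 fine mT).
rewrite -RintegralZl// -RintegralD//; apply: le_Rintegral => //.
  exact: (integrableD _ inc icst).
move=> r _; rewrite cumint_deviation.
rewrite (_ : _ - _ = mass gin * (1 - cumint (d r) n) - c r); last by rewrite /c; ring.
have d1 : 0 <= 1 - cumint (d r) n by rewrite subr_ge0 cumint_steady_dil_le1// ltW.
apply: le_trans (ler_wpM2l (powR_ge0 _ _) (ler_normB _ _)) _.
rewrite mulrDr addrC lerD2l normrM (ger0_norm d1) mulrCA ler_piMr//.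
exact: steady_dil_tail.
Qed.

Lemma deviation_energy (T : R) : 0 <= T ->
  (\int[mu]_(y in `](0:R)%R, +oo[) (deviation T y ^+ 2 / y)%:E <=
   \int[mu]_(y in `](0:R)%R, +oo[) (deviation 0 y ^+ 2 / y)%:E)%E.
Proof.
rewrite le_eqVlt => /predU1P[<-//|T0].
apply: (@weighted_L2_contraction R (gamma - 2)) => //.
- by rewrite subr_ge0.
- exact: deviation_integrable.
- exact: deviation_continuous.
- exact: deviation_evolution.
- exact: deviation_tail.
Qed.

Let measurable_weighted (u : R -> R) : measurable_fun `](0:R)%R, +oo[ u ->
  measurable_fun `](0:R)%R, +oo[ (fun x => (wmass x * (u x - mass gin * G x) ^+ 2)%:E).
Proof.
move=> mu_; have [_ [mG _] _ _ _] := hG.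
apply/measurable_EFinP; apply: measurable_funM; first exact: measurable_id.
apply: measurable_funX; apply: measurable_funB => //.
exact: measurable_funM.
Qed.

Let measurable_deviation (T : R) :
  measurable_fun `](0:R)%R, +oo[ (fun y => (deviation T y ^+ 2 / y)%:E).
Proof.
have /integrableP[/measurable_EFinP mp _] := deviation_integrable T.
apply/measurable_EFinP; apply: measurable_funM; last exact: measurable_inv_gt0.
by apply: measurable_funX; exact: measurable_funTS.
Qed.

Lemma deviation_energy_initial :
  (\int[mu]_(y in `](0:R)%R, +oo[) (deviation 0 y ^+ 2 / y)%:E =
   \int[mu]_(x in `](0:R)%R, +oo[) (wmass x * (gin x - mass gin * G x) ^+ 2)%:E)%E.
Proof.
apply: ae_eq_integral.
- exact: measurable_itv.
- exact: measurable_deviation.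
- by apply: measurable_weighted; case: gin1.
have := frag_initial hf; apply: filterS; first exact: (ae_filter_ringOfSetsType mu).
move=> y fy; rewrite /= in_itv/= andbT => y0; congr EFin.
rewrite /deviation maxxx fy /scale_factor maxxx addr0 powR1 /steady_dil !mul1r.
by rewrite !mdensE// /wmass; field; rewrite gt_eqF.
Qed.

Lemma deviation_energy_selfsim (g : R -> R) (t : R) : 0 <= t ->
  measurable_fun `](0:R)%R, +oo[ g ->
  {ae mu, forall x : R, 0 < x ->
    g x = expR (- 2 * t) * f (expR (gamma * t) - 1) (expR (- t) * x)} ->
  (\int[mu]_(y in `](0:R)%R, +oo[) (deviation (expR (gamma * t) - 1) y ^+ 2 / y)%:E =
   (expR t ^+ 2)%:E *
   \int[mu]_(x in `](0:R)%R, +oo[) (wmass x * (g x - mass gin * G x) ^+ 2)%:E)%E.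
Proof.
move=> t0 mg hg; set T := expR (gamma * t) - 1.
have gamma0 : 0 < gamma by apply: lt_le_trans gamma2.
have T0 : 0 <= T by rewrite subr_ge0 -expR0 ler_expR mulr_ge0// (ltW gamma0).
(* At time [T] the scale factor is [e^t], so that returning to self-similar variables turns the
   dilated profile back into [G]. *)
have sfT : scale_factor gamma T = expR t.
  rewrite /scale_factor (max_idPl T0) /T addrC subrK /powR gt_eqF ?expR_gt0//.
  by rewrite expRK mulrA mulVf ?mul1r// gt_eqF.
have e0 := expR_gt0 t.
rewrite (@ge0_integral_dilation R (expR (- t)))//; last 2 first.
- exact: expR_gt0.
- move=> y; rewrite /= in_itv/= andbT => y0.
  by rewrite lee_fin divr_ge0 ?sqr_ge0 ?(ltW y0).
rewrite preimage_dilation_oo ?expR_gt0//.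
(* At [e^(-t) x] the deviation is [e^t x (g - rho G)]. Its square divided by [e^(-t) x] carries
   [e^(3 t)], and the Jacobian [e^(-t)] leaves [e^(2 t)]. *)
have -> : (\int[mu]_(y in `](0:R)%R, +oo[)
      (deviation T (expR (- t) * y) ^+ 2 / (expR (- t) * y))%:E =
    \int[mu]_(x in `](0:R)%R, +oo[)
      ((expR t ^+ 3)%:E * (wmass x * (g x - mass gin * G x) ^+ 2)%:E))%E.
  apply: ae_eq_integral.
  - exact: measurable_itv.
  - apply: (measurable_comp (F := `](0:R)%R, +oo[)) (measurable_deviation T) _.
    + exact: measurable_itv.
    + move=> _ [x + <-]; rewrite /= !in_itv/= !andbT => x0.
      by rewrite mulr_gt0// expR_gt0.
    + by apply: measurable_funTS; exact: mulrl_measurable.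
  - by apply: measurable_funeM; exact: measurable_weighted.
  move: hg; apply: filterS; first exact: (ae_filter_ringOfSetsType mu).
  move=> x gx; rewrite /= in_itv/= andbT => x0; congr EFin.
  have ex0 : 0 < expR (- t) * x by rewrite mulr_gt0// expR_gt0.
  rewrite gx// /deviation (max_idPl T0) sfT /steady_dil.
  rewrite (mulrA (expR t)) expRxMexpNx_1 mul1r !mdensE// /wmass -/T.
  rewrite mulNr mulr_natl expRN expRN mulr2n expRD.
  by field; rewrite !gt_eqF.
rewrite ge0_integralZl//.
- rewrite muleA -EFinM; congr (_%:E * _)%E.
  by rewrite expRN exprS mulKf// gt_eqF.
- exact: measurable_weighted.
- move=> x; rewrite /= in_itv/= andbT => x0.
  by rewrite lee_fin mulr_ge0 ?sqr_ge0// /wmass ltW.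
Qed.

End deviation.

Theorem theorem1p1 (R : realType) (gamma : R) (gin : R -> R)
    (g : R -> R -> R) (G : R -> R)
    (hgamma : 2 <= gamma)
    (hgin1 : inL1 (@wmass R) gin) (hgin2 : inL2 (@wmass R) gin)
    (hg : selfsim_solution gamma gin g)
    (hG : steady_state gamma G)
    (t : R) (ht : 0 <= t) :
  (L2norm (@wmass R) (fun x => g t x - mass gin * G x)%R <=
   L2norm (@wmass R) (fun x => gin x - mass gin * G x)%R * (expR (- t))%:E)%E.
Proof.
have [[/(_ t ht)[mg _] _] [f hf /(_ t ht) gf]] := hg.
have gamma0 : 0 < gamma by apply: lt_le_trans hgamma.
have T0 : 0 <= expR (gamma * t) - 1.
  by rewrite subr_ge0 -expR0 ler_expR mulr_ge0// (ltW gamma0).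
pose E (u : R -> R) := (\int[@lebesgue_measure R]_(x in `](0:R)%R, +oo[%classic)
  (wmass x * (u x - mass gin * G x) ^+ 2)%:E)%E.
have E_ge0 u : (0 <= E u)%E.
  apply: integral_ge0 => x; rewrite /= in_itv/= andbT => x0.
  by rewrite lee_fin mulr_ge0 ?sqr_ge0// /wmass (ltW x0).
have HE : (E (g t) <= E gin * (expR (- t) ^+ 2)%:E)%E.
  have := deviation_energy hgamma hgin1 hf hG T0.
  rewrite (deviation_energy_selfsim hgamma hf hG ht mg gf).
  rewrite (deviation_energy_initial hgamma hgin1 hf hG) -/(E _) -/(E _) => HE.
  by rewrite muleC expRN exprVn lee_pdivlMl// exprn_gt0// expR_gt0.
change (E (g t) `^ 2^-1 <= E gin `^ 2^-1 * (expR (- t))%:E)%E.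
apply: (@le_trans _ _ ((E gin * (expR (- t) ^+ 2)%:E) `^ 2^-1)%E).
  apply: gt0_ler_poweR => //; rewrite ?invr_ge0// in_itv/= leey andbT//.
  by rewrite mule_ge0// lee_fin sqr_ge0.
rewrite poweRM ?lee_fin ?sqr_ge0// poweR_EFin.
by rewrite powR12_sqrt ?sqr_ge0// sqrtr_sqr ger0_norm// expR_ge0.
Qed.
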